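(* Let $K$ be an infinite field of characteristic $p>0$ and let $n\ge r$ be positive integers. Let $\lambda,\mu\in\wedge^+(n,r)$ be partitions such that $\lambda=(\lambda_1,\dots,\lambda_m)$ and $\mu=(\mu_1,\mu_2)$, where $\lambda_m\neq 0$, $m\ge 2$ and $\mu_2\le\lambda_1\le\mu_1$. Suppose that $p$ divides all of the following integers: \[ R(\lambda_1-\mu_2+1,\,l),\quad\text{where } l=\min\{\lambda_2,\mu_1-\lambda_1\}, \] \[ R(\lambda_i+1,\lambda_{i+1}),\quad i=2,\dots,m-1. \] Then the map \[ \psi=\sum_{T\in\mathrm{ST}_\lambda(\mu)}\phi_T : D(\lambda)\to\Delta(\mu) \] induces a nonzero homomorphism of $S$-modules $\Delta(\lambda)\to\Delta(\mu)$; that is, $\psi$ factors as $\bar\psi\circ d'_\lambda$ for a nonzero $S$-homomorphism $\bar\psi:\Delta(\lambda)\to\Delta(\mu)$.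
   Context: **Integers $R(x,y)$.** For positive integers $x,y$, $R(x,y)=\gcd\{\binom{x}{1},\binom{x+1}{2},\dots,\binom{x+y-1}{y}\}$. For a positive integer $x$, $R(x,0)=0$. **Partitions.** $\wedge(n,r)$ is the set of sequences $(a_1,\dots,a_n)$ of nonnegative integers with sum $r$. $\wedge^+(n,r)$ is the subset of weakly decreasing sequences (partitions of $r$ with at most $n$ parts); trailing zeros may be omitted. The transpose partition $\lambda^t$ of $\lambda$ is given by $\lambda^t_j=\#\{i:\lambda_i\ge j\}$. **Schur algebra and divided powers.** $S=S_K(n,r)$ is the Schur algebra; $S$-modules are the same as homogeneous polynomial representations of $GL_n(K)$ of degree $r$. $V=K^n$ is the natural module with canonical basis $e_1<\dots<e_n$, where $e_i$ is written simply as $i$. $DV=\bigoplus_{i\ge0}D_iV$ is the divided power algebra of $V$ (the graded dual of the Hopf algebra $\mathrm{Sym}(V^* )$). It is a Hopf algebra with $v^{(i)}v^{(j)}=\binom{i+j}{j}v^{(i+j)}$ and $v^{(i)}\mapsto\sum_j v^{(j)}\otimes v^{(i-j)}$ under comultiplication, for $v\in V$. The monomials $1^{(a_1)}\cdots n^{(a_n)}$ with $\sum_j a_j=i$ form a basis of $D_iV$. For a sequence $a=(a_1,\dots,a_k)$ of nonnegative integers, $D(a)=D_{a_1}V\otimes\cdots\otimes D_{a_k}V$ and $\Lambda(a)=\Lambda^{a_1}V\otimes\cdots\otimes\Lambda^{a_k}V$, with tensor products over $K$. **Weyl modules.** For $\lambda\in\wedge^+(n,r)$, the Weyl module $\Delta(\lambda)$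 is the image of the $S$-map $d'_\lambda:D(\lambda)\to\Lambda(\lambda^t)$ of Akin–Buchsbaum–Weyman. This map is the composition of: (i) the tensor product over the rows $i$ of the iterated comultiplications $D_{\lambda_i}V\to V^{\otimes\lambda_i}$, whose tensor factors are indexed by the boxes of row $i$ of the diagram of $\lambda$ from left to right; (ii) the rearrangement of the tensor factors by columns (columns left to right, each column top to bottom); (iii) the tensor product over the columns $j$ of the multiplications $V^{\otimes\lambda^t_j}\to\Lambda^{\lambda^t_j}V$. Thus $d'_\lambda:D(\lambda)\to\Delta(\lambda)$ is surjective. An $S$-map $\psi:D(\lambda)\to M$ induces a homomorphism $\Delta(\lambda)\to M$ if $\psi$ vanishes on $\ker d'_\lambda$. **Tableaux.** For $\mu=(\mu_1,\mu_2)$, a tableau of shape $\mu$ is a filling of the diagram of $\mu$ with entries from $\{1,\dots,n\}$. It is standard if the entries weakly increase along rows from left to right and strictly increase down columns. Its weight is $(\alpha_1,\dots,\alpha_n)$, where $\alpha_i$ is the number of entries equal to $i$. $\mathrm{ST}_\nu(\mu)$ is the set of standard tableaux of shape $\mu$ and weight $\nu$. **The maps $\phi_T$.** Let $\nu=(\nu_1,\dots,\nu_n)\in\wedge(n,r)$ and $T\in\mathrm{ST}_\nu(\mu)$. Let $a_i$ (respectively $b_i$) be the number of entries $i$ in the first (respectively second) row of $T$; so $a_i+b_i=\nu_i$, and $a_1=\nu_1$. Then $\phi_T:D(\nu)\to\Delta(\mu)$ is the $S$-map \[ x_1\otimes\cdots\otimes x_n\mapsto\sum_{i_2,\dots,i_n}d'_\mu\bigl(x_1x_{2i_2}(a_2)\cdots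 x_{ni_n}(a_n)\otimes x_{2i_2}(b_2)'\cdots x_{ni_n}(b_n)'\bigr), \] where $\sum_{i_s}x_{si_s}(a_s)\otimes x_{si_s}(b_s)'$ is the image of $x_s$ under the component $D_{\nu_s}V\to D_{a_s}V\otimes D_{b_s}V$ of the comultiplication, $s=2,\dots,n$. For a partition $\lambda=(\lambda_1,\dots,\lambda_m)$ this is applied with $\nu=\lambda$ extended by zeros. *)

(* Defs.v *)
From HB Require Import structures.
From mathcomp Require Import all_boot all_order all_algebra.

Set Implicit Arguments.
Unset Strict Implicit.
Unset Printing Implicit Defensive.

Import GRing.Theory.
Local Open Scope ring_scope.

(* gcd of 'C(x, 1), 'C(x + 1, 2), ..., 'C(x + y - 1, y); it is 0 for y = 0. *)
Definition Rgcd (x y : nat) : nat :=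
  (\big[gcdn/0]_(1 <= i < y.+1) 'C(x + i - 1, i))%N.

(* Trailing zeros may be present or omitted. *)
Definition is_partition (n r : nat) (s : seq nat) : bool :=
  [&& (size s <= n)%N, sorted geq s & sumn s == r].

(* The i-th part, counted from 1. *)
Definition part (s : seq nat) (i : nat) : nat := nth 0%N s i.-1.

Section Tensors.
Variable K : fieldType.

(* Free K-module with finite basis B; an element is its coordinate function. *)
Notation free_mod B := {ffun B -> K^o}.

Definition basis_vec (B : finType) (b : B) : free_mod B :=
  [ffun b' => (b' == b)%:R].

(* The linear map sending each basis vector b to f b. *)
Definition lin_ext (B : finType) (W : vectType K) (f : B -> W) :
    'Hom(free_mod B, W) :=
  linfun (fun x : free_mod B => \sum_(b : B) x b *: f b).

(* The tensor product of free modules is free on families of basis elements. *)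
Definition tbasis (I : finType) (B : I -> finType) : finType :=
  {dffun forall i : I, B i}.

Definition pure_tensor (I : finType) (B : I -> finType)
    (x : forall i, free_mod (B i)) : free_mod (tbasis B) :=
  [ffun A : tbasis B => \prod_(i : I) x i (A i)].

Definition tensor_map (I : finType) (B C : I -> finType)
    (f : forall i, 'Hom(free_mod (B i), free_mod (C i))) :
    'Hom(free_mod (tbasis B), free_mod (tbasis C)) :=
  lin_ext (fun A : tbasis B =>
             pure_tensor (fun i : I => f i (basis_vec (A i)))).

(* The linear map sending each basis vector b to the basis vector f b. *)
Definition relabel (B C : finType) (f : B -> C) :
    'Hom(free_mod B, free_mod C) :=
  lin_ext (fun b => basis_vec (f b)).

End Tensors.

Notation free_mod K B := {ffun B -> K^o}.

Section WeylModules.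
Variables (K : fieldType) (n : nat).

(* Vectors of V = K^n are written as rows, with 1, ..., n indexed by 'I_n.
   [gvec g i] is the image of the i-th basis vector under g, i.e. the i-th
   column of g. *)
Definition gvec (g : 'M[K]_n) (i : 'I_n) : 'rV[K]_n := row i g^T.

(** Divided powers *)

(* The element m stands for the monomial 1^(m_1) ... n^(m_n) of D_d V. *)
Definition dbasis (d : nat) : finType :=
  {m : {ffun 'I_n -> 'I_d.+1} | (\sum_(j < n) m j)%N == d}.

Definition dexp (d : nat) (m : dbasis d) (j : 'I_n) : nat := val m j.

Definition Dpow (d : nat) : vectType K := free_mod K (dbasis d).

(* v^(d) for a vector v *)
Definition divpow (v : 'rV[K]_n) (d : nat) : Dpow d :=
  [ffun m : dbasis d => \prod_(j < n) v 0 j ^+ dexp m j].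

Section Families.
Variables (I : finType) (c : I -> nat).

Definition Dbasis : finType := tbasis (fun i => dbasis (c i)).

(* The tensor product of the D_(c_i) V. *)
Definition Dtens : vectType K := free_mod K Dbasis.

(* The exponents of P add up to those of m. *)
Definition exp_sum (d : nat) (P : Dbasis) (m : dbasis d) : bool :=
  [forall j, (\sum_(i : I) dexp (P i) j)%N == dexp m j].

(* Iterated multiplication to D_d V, where d is the sum of the c_i: since
   v^(i) v^(j) = 'C(i + j, j) v^(i + j), a product of monomials is a product
   of multinomial coefficients times the monomial with added exponents. *)
Definition Dmul (d : nat) : 'Hom(Dtens, Dpow d) :=
  lin_ext (fun P : Dbasis => \sum_(m : dbasis d | exp_sum P m)
    (\prod_(j < n) ((dexp m j)`! %/ \prod_(i : I) (dexp (P i) j)`!))%N%:R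
      *: basis_vec K m).

(* The component D_d V -> (x)_i D_(c_i) V of the iterated comultiplication,
   where d is the sum of the c_i. *)
Definition Dcomul (d : nat) : 'Hom(Dpow d, Dtens) :=
  lin_ext (fun m : dbasis d =>
             \sum_(P : Dbasis | exp_sum P m) basis_vec K P).

End Families.

(* Words of length d: the canonical basis of the d-th tensor power of V. *)
Definition word (d : nat) : finType := {ffun 'I_d -> 'I_n}.

Definition content (d : nat) (w : word d) (l : 'I_n) : nat :=
  #|[set j : 'I_d | w j == l]|.

(* The iterated comultiplication from D_d V to the d-th tensor power of V. *)
Definition DcomulV (d : nat) : 'Hom(Dpow d, free_mod K (word d)) :=
  lin_ext (fun m : dbasis d =>
    \sum_(w : word d | [forall l, content w l == dexp m l]) basis_vec K w).

(** Exterior powers *)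

(* t stands for e_(t_1) /\ ... /\ e_(t_b), where t_1 < ... < t_b. *)
Definition lbasis (b : nat) : finType :=
  {t : b.-tuple 'I_n | sorted ltn (map val t)}.

Definition Lpow (b : nat) : vectType K := free_mod K (lbasis b).

(* The wedge product of the rows of M, top to bottom; its coordinates are
   the maximal minors of M. *)
Definition wedge (b : nat) (M : 'M[K]_(b, n)) : Lpow b :=
  [ffun t : lbasis b => \det (colsub (tnth (val t)) M)].

Definition Lmul (b : nat) : 'Hom(free_mod K (word b), Lpow b) :=
  lin_ext (fun w : word b => wedge (\matrix_(i < b) delta_mx 0 (w i))).

Definition Ltens (I : finType) (b : I -> nat) : vectType K :=
  free_mod K (tbasis (fun j => lbasis (b j))).

(** The action of GL_n(K) *)

(* g 1^(m_1) ... n^(m_n) = (g 1)^(m_1) ... (g n)^(m_n) *)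
Definition Dact (d : nat) (g : 'M[K]_n) : 'End(Dpow d) :=
  lin_ext (fun m : dbasis d =>
    Dmul (dexp m) d (pure_tensor (fun i => divpow (gvec g i) (dexp m i)))).

Definition Dtens_act (I : finType) (c : I -> nat) (g : 'M[K]_n) :
    'End(Dtens c) :=
  tensor_map (fun i => Dact (c i) g).

Definition Lact (b : nat) (g : 'M[K]_n) : 'End(Lpow b) :=
  lin_ext (fun t : lbasis b =>
             wedge (\matrix_(i < b) gvec g (tnth (val t) i))).

Definition Ltens_act (I : finType) (b : I -> nat) (g : 'M[K]_n) :
    'End(Ltens b) :=
  tensor_map (fun j => Lact (b j) g).

(** Weyl modules *)

Section Shape.
Variables (k : nat) (a : 'I_k -> nat).

(* For a partition this is the first part. *)
Definition ncols : nat := (\max_(i < k) a i)%N.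

Definition col (j : 'I_ncols) : {set 'I_k} := [set i | (j < a i)%N].

Definition transp (j : 'I_ncols) : nat := #|col j|.

(* The row of the i-th box of column j, from top to bottom. *)
Definition col_row (j : 'I_ncols) (i : 'I_(transp j)) : 'I_k :=
  enum_val (A := pred_of_set (col j)) i.

Lemma col_rowP (j : 'I_ncols) (i : 'I_(transp j)) : (j < a (col_row i))%N.
Proof. by have := enum_valP (A := pred_of_set (col j)) i; rewrite inE. Qed.

(* A filling of the diagram: T i j is the entry in row i and column j. Fillings
   are the basis of the tensor product of copies of V indexed by the boxes. *)
Definition filling : finType := tbasis (fun i => word (a i)).

Definition by_columns (T : filling) : tbasis (fun j => word (transp j)) :=
  [ffun j => [ffun i => T (col_row i) (Ordinal (col_rowP i))]].

Definition dprime : 'Hom(Dtens a, Ltens transp) :=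
  (tensor_map (fun j => Lmul (transp j))
     \o relabel K by_columns
     \o tensor_map (fun i => DcomulV (a i)))%VF.

Definition Weyl : {vspace Ltens transp} := limg dprime.

(* dprime with codomain its image; vsproj is the inverse of the inclusion vsval
   on elements of Weyl. *)
Definition dWeyl : 'Hom(Dtens a, subvs_of Weyl) :=
  linfun (fun x => vsproj Weyl (dprime x)).

Definition standard (T : filling) : bool :=
  [forall i : 'I_k, forall j : 'I_(a i), forall j' : 'I_(a i),
     (j <= j')%N ==> (T i j <= T i j')%N] &&
  [forall i : 'I_k, forall i' : 'I_k, forall j : 'I_(a i), forall j' : 'I_(a i'),
     (i < i')%N && (j == j' :> nat) ==> (T i j < T i' j')%N].

Definition ST (nu : 'I_n -> nat) : {set filling} :=
  [set T | standard T &
     [forall l, (\sum_(i < k) content (T i) l)%N == nu l]].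

(* The map phi_T. Entries s in row i of T are counted by content (T i) s. Each
   factor x_s, including x_1, is comultiplied; the first column of a standard
   T forces all 1's into the first row, so x_1 just becomes x_1 (x) 1. *)
Definition phi (nu : 'I_n -> nat) (T : filling) :
    'Hom(Dtens nu, subvs_of Weyl) :=
  (dWeyl
     \o tensor_map (fun i => Dmul (content (T i)) (a i))
     \o relabel K
          (fun P : tbasis (fun s => Dbasis (fun i : 'I_k => content (T i) s)) =>
             [ffun i => [ffun s => P s i]]
               : tbasis (fun i => Dbasis (content (T i))))
     \o tensor_map (fun s => Dcomul (fun i : 'I_k => content (T i) s) (nu s)))%VF.

End Shape.

Arguments transp {k} a j.

(* Homomorphisms of modules over the Schur algebra, i.e. of polynomial
   representations of GL_n(K). Weyl modules are stable under Ltens_act, as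
   dprime commutes with the actions, so vsproj only restricts the codomain. *)
Definition S_hom (k l : nat) (a : 'I_k -> nat) (b : 'I_l -> nat)
    (f : 'Hom(subvs_of (Weyl a), subvs_of (Weyl b))) : Prop :=
  forall (g : 'M[K]_n) (u : subvs_of (Weyl a)), g \in unitmx ->
    vsval (f (vsproj (Weyl a) (Ltens_act (transp a) g (vsval u)))) =
    Ltens_act (transp b) g (vsval (f u)).

End WeylModules.

(* Main.v *)
(* On the generators v_1^(la_1) (x) ... (x) v_n^(la_n) of D(la), which span since
   K is infinite, dprime takes the value (x)_j (v_1 /\ ... /\ v_(la^t_j)).  Writing
   w = sum_(i >= 2) s_i v_i, the value of psi is the coefficient of s^la in
     d'_mu ((s_1 v_1 + w)^(mu_1) (x) w^(mu_2))
       = (s_1 v_1 /\ w)^(x mu_2) (x) (s_1 v_1 + w)^(x (mu_1 - mu_2)).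
   Replacing v_(i+1) by v_(i+1) + v_i amounts to replacing s_i by s_i + s_(i+1),
   except that for i = 1 the factor s_1^(mu_2) is unaffected.  Hence psi is
   unchanged as soon as the coefficients 'C(la_i + k, k), respectively
   'C(la_1 - mu_2 + k, k), vanish in K, which is the divisibility hypothesis.
   Conversely dprime is universal for maps invariant under these row operations:
   an invariant map is determined by its values on standard basis elements, and
   the images of the standard basis elements under dprime are linearly
   independent. *)
From HB Require Import structures.
From Stdlib Require Import FunctionalExtensionality.
From mathcomp Require Import all_boot all_order all_algebra all_fingroup zify ring.
Require Import Defs.
Import GRing.Theory.
Local Open Scope ring_scope.
Set Implicit Arguments.
Unset Strict Implicit.
Unset Printing Implicit Defensive.

(** * Free modules and tensor products *)

(** The obstacle is that divided powers in characteristic p allow no division, so coefficients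
    cannot be recovered by rescaling. Instead, identities are tested on [divpows X] for all matrices
    X, and infinity of K turns an identity of polynomial functions of X into one of coefficients
    ([monom_indep], [monom_coef_eq]). The kernel of dprime is never described by generators: it
    enters only through invariance under adding row i of X to row i + 1. Coefficient 1 suffices for
    this operation because X is arbitrary and can be degenerated. Universality rests on one weight
    function used in both directions. Straightening takes an element of maximal weight in the
    support of an invariant functional; the term isolated there has only binomials C(e, e) and C(e,
    0), hence coefficient 1 in every characteristic. Independence takes an element of minimal weight
    and isolates it by one coordinate. The bound mu_1 - la_1 in the first divisibility hypothesis
    appears because all letters 1 lie in row one, so the exponent of s_1 never exceeds mu_1. *)

Lemma bigA_distr_tbasis (R : pzSemiRingType) (I : finType) (B : I -> finType)
    (F : forall i, B i -> R) :
  \prod_i \sum_(b : B i) F i b = \sum_(A : tbasis B) \prod_i F i (A i).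
Proof.
rewrite (reindex (@dffun_of_fprod I B)) /=; last first.
  by apply: onW_bij; exact: dffun_of_fprod_bij.
under [RHS]eq_bigr do under eq_bigr do rewrite ffunE.
pose G i : {ffun B i -> R} := [ffun b => F i b].
transitivity (\sum_(t : fprod B) \prod_i G i (t i)); last first.
  by apply: eq_bigr => t _; apply: eq_bigr => i _; rewrite ffunE.
rewrite big_fprod -(bigA_distr_big_dep (fun i => tagged_with B i) (fun i => untag 0 (G i))).
apply: eq_bigr => i _.
by rewrite -(big_tag (G : forall i, B i -> R)); apply: eq_bigr => b _; rewrite ffunE.
Qed.

Section FreeModules.
Variable K : fieldType.

Lemma scale_regE (a : K) (b : K^o) : a *: b = a * b. Proof. by []. Qed.

Lemma free_scaleE (B : finType) (a : K) (x : free_mod K B) b : (a *: x) b = a * x b.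
Proof. by rewrite ffunE. Qed.

Lemma sum_basis_vec (B : finType) (Q : pred B) c :
  (\sum_(b | Q b) basis_vec K b) c = (Q c)%:R.
Proof.
rewrite sum_ffunE; case Qc: (Q c); last first.
  rewrite big1 // => b Qb; rewrite ffunE; case: eqP => // e.
  by rewrite e Qb in Qc.
rewrite (bigD1 c) //= ffunE eqxx big1 ?addr0 // => b /andP [_ /negPf ne].
by rewrite ffunE eq_sym ne.
Qed.

(** [linfun] computes as the given function only when that function carries a linear structure,
    which is built and packed inside the proof. *)
Lemma lin_extE (B : finType) (W : vectType K) (f : B -> W) (x : free_mod K B) :
  lin_ext f x = \sum_(b : B) x b *: f b.
Proof.
pose F (x : free_mod K B) : W := \sum_(b : B) x b *: f b.
have lin : linear F.
  move=> k u v; rewrite scaler_sumr -big_split; apply: eq_bigr => b _ /=.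
  by rewrite !ffunE scalerDl scalerA.
pose g := GRing.isLinear.Build _ _ _ _ F lin.
pose h : {linear free_mod K B -> W} := HB.pack F g.
exact: (lfunE h).
Qed.

Lemma free_mod_expand (B : finType) (x : free_mod K B) :
  x = \sum_(b : B) x b *: basis_vec K b.
Proof.
apply/ffunP => b; rewrite sum_ffunE (bigD1 b) //= big1 => [|c /negPf neq].
  by rewrite addr0 !ffunE eqxx scale_regE mulr1.
by rewrite !ffunE eq_sym neq scaler0.
Qed.

Lemma free_mod_lin (B : finType) (W : vectType K)
    (f : 'Hom(free_mod K B, W)) (x : free_mod K B) :
  f x = \sum_(b : B) x b *: f (basis_vec K b).
Proof.
rewrite {1}(free_mod_expand x) linear_sum.
by apply: eq_bigr => b _; rewrite linearZ.
Qed.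

Section Tensor.
Variables (I : finType) (B : I -> finType).

Lemma pure_tensor_sum (J : I -> finType) (a : forall i, J i -> K)
    (y : forall i, J i -> free_mod K (B i)) :
  pure_tensor (fun i => \sum_(j : J i) a i j *: y i j) =
  \sum_(c : tbasis J) (\prod_i a i (c i)) *: pure_tensor (fun i => y i (c i)).
Proof.
apply/ffunP => A; rewrite ffunE sum_ffunE.
under eq_bigr do rewrite sum_ffunE.
rewrite bigA_distr_tbasis; apply: eq_bigr => c _.
rewrite !ffunE scale_regE -big_split /=.
by apply: eq_bigr => i _; rewrite !ffunE.
Qed.

Lemma eq_pure_tensor (x y : forall i, free_mod K (B i)) :
  (forall i, x i = y i) -> pure_tensor x = pure_tensor y.
Proof.
by move=> exy; apply/ffunP => A; rewrite !ffunE; apply: eq_bigr => i _; rewrite exy.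
Qed.

End Tensor.

Lemma tensor_map_pure (I : finType) (B C : I -> finType)
    (f : forall i, 'Hom(free_mod K (B i), free_mod K (C i)))
    (x : forall i, free_mod K (B i)) :
  tensor_map f (pure_tensor x) = pure_tensor (fun i => f i (x i)).
Proof.
rewrite lin_extE.
rewrite [RHS](eq_pure_tensor (fun i => free_mod_lin (f i) (x i))) pure_tensor_sum.
by apply: eq_bigr => A _; rewrite ffunE.
Qed.

Lemma relabelE (B C : finType) (f : B -> C) (g : C -> B) (x : free_mod K B) (c : C) :
  cancel f g -> cancel g f -> relabel K f x c = x (g c).
Proof.
move=> fK gK; rewrite lin_extE sum_ffunE (bigD1 (g c)) //= big1 => [|b neq].
  by rewrite !ffunE gK eqxx addr0 scale_regE mulr1.
rewrite !ffunE; case: eqP => [e|]; last by rewrite scaler0.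
by rewrite e fK eqxx in neq.
Qed.

End FreeModules.

(** * Polynomial identities over an infinite field *)

Section InfiniteField.
Variable K : fieldType.
Hypothesis K_infinite : forall s : seq K, exists x : K, x \notin s.

Lemma infinite_root_poly0 (q : {poly K}) : (forall x, q.[x] = 0) -> q = 0.
Proof.
move=> q0; apply/eqP; apply: contraT => qn0.
have [s [us ss]] : exists s : seq K, uniq s /\ size s = size q.
  elim: (size q) => [|k [s [us ss]]]; first by exists [::].
  by have [x xs] := K_infinite s; exists (x :: s); rewrite /= xs us ss.
suff : (size s < size q)%N by rewrite ss ltnn.
by apply: max_poly_roots => //; apply/allP => x _; apply/rootP.
Qed.

Lemma poly_fun_ext (q1 q2 : {poly K}) : (forall x, q1.[x] = q2.[x]) -> q1 = q2.
Proof.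
move=> e; apply/eqP; rewrite -subr_eq0; apply/eqP; apply: infinite_root_poly0.
by move=> x; rewrite hornerD hornerN e subrr.
Qed.

Definition monom (J : finType) (s : J -> K) (e : J -> nat) : K :=
  \prod_j s j ^+ e j.

Lemma radix_inj (N k : nat) (a b : 'I_k -> nat) :
  (forall i, a i < N)%N -> (forall i, b i < N)%N ->
  (\sum_(i < k) a i * N ^ i = \sum_(i < k) b i * N ^ i)%N -> a =1 b.
Proof.
elim: k a b => [a b _ _ _ []//|k IHk a b la lb].
rewrite !big_ord_recl /= !muln1.
under eq_bigr do rewrite /bump /= add1n expnSr mulnA.
under [X in (_ = _ + X)%N -> _]eq_bigr do rewrite /bump /= add1n expnSr mulnA.
rewrite -!big_distrl /= => e.
have N0 : (0 < N)%N by apply: leq_ltn_trans (la ord0).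
have e0 : a ord0 = b ord0.
  by have := congr1 (modn^~ N) e; rewrite ![(_ ord0 + _)%N]addnC !modnMDl !modn_small.
move: e; rewrite e0 => /addnI/eqP; rewrite eqn_pmul2r // => /eqP e i.
have IH := IHk _ _ (fun i => la (lift ord0 i)) (fun i => lb (lift ord0 i)) e.
by case: (unliftP ord0 i) => [j ->|->]; rewrite ?e0 ?IH.
Qed.

(* Kronecker substitution: [s j = y ^+ (N ^ j)] separates all monomials
   with exponents below [N], reducing the claim to one variable. *)
Lemma monom_indep (J B : finType) (e : B -> J -> nat) (c : B -> K) (e0 : J -> nat) :
  (forall s : J -> K, \sum_b c b * monom s (e b) = 0) ->
  \sum_(b | [forall j, e b j == e0 j]) c b = 0.
Proof.
move=> vanish.
pose N := (\max_(b : B) \max_(j : J) (e b j) + \max_(j : J) e0 j).+1.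
have ltN b j : (e b j < N)%N.
  by rewrite ltnS (leq_trans _ (leq_addr _ _)) // (bigmax_sup b) // (bigmax_sup j).
have ltN0 j : (e0 j < N)%N.
  by rewrite ltnS (leq_trans _ (leq_addl _ _)) // (bigmax_sup j).
pose kron (f : J -> nat) := (\sum_(i < #|J|) f (enum_val i) * N ^ i)%N.
pose q : {poly K} := \sum_b c b *: 'X^(kron (e b)).
have q0 : q = 0.
  apply: infinite_root_poly0 => y; rewrite horner_sum.
  rewrite -[RHS](vanish (fun j => y ^+ (N ^ enum_rank j))).
  apply: eq_bigr => b _; rewrite hornerZ hornerXn; congr (_ * _).
  rewrite /kron /monom -prodrXr; under [RHS]eq_bigr do rewrite -exprM mulnC.
  rewrite [RHS](reindex (@enum_val J J)) /=; last exact/onW_bij/enum_val_bij.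
  by apply: eq_bigr => i _; rewrite enum_valK.
rewrite -[RHS](coef0 K (kron e0)) -q0 coef_sum.
rewrite big_mkcond /=; apply: eq_bigr => b _; rewrite coefZ coefXn.
case: forallP => [/(_ _) H|H].
  have -> : kron e0 = kron (e b) by apply: eq_bigr => i _; rewrite (eqP (H _)).
  by rewrite eqxx mulr1.
case: eqP => [E|]; last by rewrite mulr0.
case: H => j; apply/eqP; rewrite -(enum_rankK j); apply/esym.
exact: (radix_inj (fun i => ltN0 (enum_val i)) (fun i => ltN b (enum_val i))).
Qed.

(** The two families are put side by side over [B + C], the second with opposite sign. The terms may
    thus be indexed by different types and may repeat exponents. *)
Lemma monom_coef_eq (J B C : finType) (e : B -> J -> nat) (c : B -> K)
    (f : C -> J -> nat) (d : C -> K) (e0 : J -> nat) :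
  (forall s : J -> K, \sum_b c b * monom s (e b) = \sum_b d b * monom s (f b)) ->
  \sum_(b | [forall j, e b j == e0 j]) c b =
  \sum_(b | [forall j, f b j == e0 j]) d b.
Proof.
move=> E; apply/eqP; rewrite -subr_eq0; apply/eqP.
pose h (b : B + C) := match b with inl b => e b | inr b => f b end.
pose k (b : B + C) := match b with inl b => c b | inr b => - d b end.
have := @monom_indep J (B + C)%type h k e0.
rewrite big_sumType /= -sumrN; apply => s.
by rewrite big_sumType /= E -big_split /=; apply: big1 => b _; rewrite mulNr subrr.
Qed.

End InfiniteField.

(** * Multinomial coefficients *)

Section Exponents.
Variable n : nat.

Lemma dexp_sum d (m : dbasis n d) : (\sum_j dexp m j)%N = d.
Proof. exact/eqP/(valP m). Qed.

Lemma dexp_inj d (m m' : dbasis n d) : dexp m =1 dexp m' -> m = m'.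
Proof. by move=> e; apply/val_inj/ffunP => j; apply/val_inj/e. Qed.

Lemma dexp_le d (m : dbasis n d) j : (dexp m j <= d)%N.
Proof. by rewrite -ltnS ltn_ord. Qed.

Lemma mk_dbasis_subproof d (c : 'I_n -> nat) (sc : (\sum_j c j)%N = d) :
  (\sum_(j < n) [ffun j => inord (c j) : 'I_d.+1] j)%N == d.
Proof.
rewrite -[X in _ == X]sc; apply/eqP/eq_bigr => j _; rewrite ffunE inordK // ltnS -sc.
by rewrite (bigD1 j) //= leq_addr.
Qed.

Definition mk_dbasis d (c : 'I_n -> nat) (sc : (\sum_j c j)%N = d) : dbasis n d :=
  Sub [ffun j => inord (c j) : 'I_d.+1] (mk_dbasis_subproof sc).

Lemma dexp_mk d (c : 'I_n -> nat) (sc : (\sum_j c j)%N = d) : dexp (mk_dbasis sc) =1 c.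
Proof.
move=> j; rewrite /dexp /= ffunE inordK // ltnS -sc.
by rewrite (bigD1 j) //= leq_addr.
Qed.

Lemma big_dbasis_exp (R : Type) (idx : R) (op : Monoid.com_law idx) d
    (c : 'I_n -> nat) (F : dbasis n d -> R) (sc : (\sum_j c j)%N = d) :
  \big[op/idx]_(m | [forall j, dexp m j == c j]) F m = F (mk_dbasis sc).
Proof.
rewrite (big_pred1 (mk_dbasis sc)) // => m; apply/forallP/eqP => [e|-> j].
  by apply: dexp_inj => j; rewrite dexp_mk (eqP (e j)).
by rewrite dexp_mk.
Qed.

Lemma big_word_recl (R : Type) (idx : R) (op : Monoid.com_law idx) d
    (F : word n d.+1 -> R) :
  \big[op/idx]_w F w = \big[op/idx]_x \big[op/idx]_(w : word n d)
    F [ffun j => if unlift ord0 j is Some j' then w j' else x].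
Proof.
pose h (p : 'I_n * word n d) : word n d.+1 :=
  [ffun j => if unlift ord0 j is Some j' then p.2 j' else p.1].
pose h' (w : word n d.+1) : 'I_n * word n d := (w ord0, [ffun j => w (lift ord0 j)]).
have hK : cancel h h'.
  case=> x w; congr pair => /=; first by rewrite ffunE unlift_none.
  by apply/ffunP => j; rewrite !ffunE liftK.
have h'K : cancel h' h.
  by move=> w; apply/ffunP => j; rewrite ffunE; case: unliftP => [j' ->|->] //=; rewrite ffunE.
rewrite pair_big /= (reindex h) //; exact/onW_bij/(Bijective hK h'K).
Qed.

Lemma content_cons d x (w : word n d) l :
  content [ffun j => if unlift ord0 j is Some j' then w j' else x] l =
  ((x == l) + content w l)%N.
Proof.
rewrite /content -!sum1dep_card big_mkcond big_ord_recl /= ffunE unlift_none.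
congr (_ + _)%N; rewrite [RHS]big_mkcond; apply: eq_bigr => j _.
by rewrite ffunE liftK.
Qed.

Lemma content_sum d (w : word n d) : (\sum_l content w l)%N = d.
Proof.
rewrite -[RHS]card_ord -sum1_card (partition_big w predT) //=.
by apply: eq_bigr => l _; rewrite sum1_card /content cardsE.
Qed.

(** The multinomial coefficient as a word count, in product form so that the induction on the first
    letter involves no division. *)
Lemma card_content d (c : 'I_n -> nat) : (\sum_l c l)%N = d ->
  (#|[set w : word n d | [forall l, content w l == c l]]| * \prod_l (c l)`! = d`!)%N.
Proof.
rewrite -sum1dep_card; elim: d c => [c|d IHd c sc].
  move/eqP; rewrite sum_nat_eq0 => /forallP c0.
  rewrite [X in (_ * X)%N]big1 => [|l _]; last by rewrite (eqP (c0 l)).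
  rewrite muln1 sum1dep_card (_ : [set _ | _] = setT).
    by rewrite cardsT card_ffun !card_ord expn0.
  apply/setP => w; rewrite !inE; apply/forallP => l; rewrite (eqP (c0 l)).
  by rewrite /content cards_eq0; apply/eqP/setP => -[].
rewrite big_mkcond big_word_recl big_distrl /=.
(* The words that start with l contribute [c l * d!]: removing the letter lowers the factorial of
   [c l] by one step. *)
transitivity (\sum_l c l * d`!)%N; last by rewrite -big_distrl sc.
apply: eq_bigr => x _; rewrite -big_mkcond /=.
case cx: (c x) => [|k].
  rewrite big_pred0 // => w; apply/negP => /forallP /(_ x).
  by rewrite content_cons eqxx cx.
pose c' l := (c l - (x == l))%N.
have c'E l : (c l = (x == l) + c' l)%N.
  by rewrite /c' subnKC //; case: eqP => [<-|//]; rewrite cx.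
have sc' : (\sum_l c' l)%N = d.
  have : (\sum_l c l = 1 + \sum_l c' l)%N.
    rewrite (eq_bigr _ (fun l _ => c'E l)) big_split /=; congr (_ + _)%N.
    by rewrite (bigD1 x) //= eqxx big1 // => l; rewrite eq_sym => /negPf ->.
  by rewrite sc add1n => -[].
rewrite -(IHd _ sc') mulnCA; congr (_ * _)%N.
  apply: eq_bigl => w; apply: eq_forallb => l.
  by rewrite content_cons c'E eqn_add2l.
rewrite (bigD1 x) //= cx factS -cx [in RHS](bigD1 x) //= mulnA; congr (_ * _ * _)%N.
  by rewrite /c' eqxx cx subn1.
by apply: eq_bigr => l /negPf; rewrite c'E eq_sym => ->.
Qed.

End Exponents.

Section Multinomial.
Variables (K : fieldType) (n : nat).

Lemma prod_content d (y : 'I_n -> K) (w : word n d) :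
  \prod_(j < d) y (w j) = \prod_l y l ^+ content w l.
Proof.
rewrite (partition_big w predT) //=; apply: eq_bigr => l _.
rewrite (eq_bigr (fun _ => y l)) => [|j /eqP -> //].
by rewrite prodr_const /content cardsE.
Qed.

Lemma multinomial d (y : 'I_n -> K) :
  (\sum_l y l) ^+ d =
  \sum_(c : dbasis n d) (d`! %/ \prod_l (dexp c l)`!)%:R * \prod_l y l ^+ dexp c l.
Proof.
rewrite -{1}[d]card_ord -prodr_const bigA_distr_bigA /=.
under eq_bigr do rewrite prod_content.
pose h (w : word n d) := mk_dbasis (content_sum w).
rewrite (partition_big h predT) //=; apply: eq_bigr => c _.
have <- := card_content (dexp_sum c).
rewrite mulnK ?prodn_gt0 // => [|l]; last exact: fact_gt0.
rewrite -sum1dep_card natr_sum big_distrl /=; apply: eq_big => [w|w /eqP <-].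
  apply/eqP/forallP => [<- l|e]; first by rewrite dexp_mk.
  by apply: dexp_inj => l; rewrite dexp_mk (eqP (e l)).
by rewrite mul1r; apply: eq_bigr => l _; rewrite dexp_mk.
Qed.

End Multinomial.

(** * Divided powers *)

Section DividedPowers.
Variables (K : fieldType) (n : nat).

(** The type [Dbasis n c] depends on [c]. Storing exponents under one common bound N puts all
    families into a single type, where matrices can be transposed and sums over different [c]
    exchanged. *)
Definition exp_mx (I : finType) (c : I -> nat) N (P : Dbasis n c) :
    {ffun I -> {ffun 'I_n -> 'I_N.+1}} :=
  [ffun i => [ffun j => inord (dexp (P i) j)]].

Lemma exp_mxE (I : finType) (c : I -> nat) N (P : Dbasis n c) i j :
  (c i <= N)%N -> exp_mx N P i j = dexp (P i) j :> nat.
Proof.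
by move=> le; rewrite !ffunE inordK // ltnS (leq_trans (dexp_le _ _)).
Qed.

Lemma Dbasis_inj (I : finType) (c : I -> nat) (P Q : Dbasis n c) :
  (forall i j, dexp (P i) j = dexp (Q i) j) -> P = Q.
Proof. by move=> e; apply/ffunP => i; apply: dexp_inj. Qed.

Lemma big_Dbasis (I : finType) (c : I -> nat) N
    (F : {ffun I -> {ffun 'I_n -> 'I_N.+1}} -> K) : (forall i, c i <= N)%N ->
  \sum_(P : Dbasis n c) F (exp_mx N P) =
  \sum_(E : {ffun I -> {ffun 'I_n -> 'I_N.+1}} | [forall i, (\sum_j E i j)%N == c i]) F E.
Proof.
move=> le; rewrite -(big_imset (h := @exp_mx I c N) (A := predT)) /=; last first.
  move=> P Q _ _ e; apply: Dbasis_inj => i j.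
  have := congr1 (fun E : {ffun I -> {ffun 'I_n -> 'I_N.+1}} => nat_of_ord (E i j)) e.
  by rewrite !exp_mxE.
apply: eq_bigl => E; apply/imsetP/forallP => [[P _ ->] i|sE].
  rewrite (eq_bigr (dexp (P i))) => [|j _]; first by rewrite dexp_sum.
  exact: exp_mxE.
exists ([ffun i => mk_dbasis (eqP (sE i))] : Dbasis n c) => //.
apply/ffunP => i; apply/ffunP => j; apply: val_inj; rewrite /= exp_mxE //.
by rewrite ffunE dexp_mk.
Qed.

Lemma Dmul_divpow (I : finType) (c : I -> nat) d (v : I -> 'rV[K]_n) (m : dbasis n d) :
  Dmul K n c d (pure_tensor (fun i => divpow (v i) (c i))) m =
  \sum_(P : Dbasis n c | exp_sum P m) (\prod_i \prod_j v i 0 j ^+ dexp (P i) j) *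
     (\prod_j ((dexp m j)`! %/ \prod_i (dexp (P i) j)`!))%N%:R.
Proof.
rewrite lin_extE sum_ffunE [RHS]big_mkcond; apply: eq_bigr => P _.
rewrite ffunE sum_ffunE.
have -> : pure_tensor (fun i => divpow (v i) (c i)) P =
          \prod_i \prod_j v i 0 j ^+ dexp (P i) j.
  by rewrite ffunE; apply: eq_bigr => i _; rewrite ffunE.
rewrite scale_regE; case: ifP => [PM|nPM].
  congr (_ * _); rewrite (bigD1 m) //= [X in _ + X]big1 => [|m' /andP [_ /negPf ne]].
    by rewrite addr0 free_scaleE ffunE eqxx mulr1.
  by rewrite free_scaleE ffunE eq_sym ne mulr0.
rewrite [X in _ * X]big1 ?mulr0 // => m' Pm'; rewrite free_scaleE ffunE.
case: eqP => [e|]; last by rewrite mulr0.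
by rewrite e Pm' in nPM.
Qed.

(* Both sides expand over the matrices with row sums [dexp m], indexed on the
   right by the column sums first. *)
Lemma divpow_sum d (x : 'I_n -> K) (v : 'I_n -> 'rV[K]_n) :
  divpow (\sum_s x s *: v s) d =
  \sum_(c : dbasis n d) (\prod_s x s ^+ dexp c s) *:
     Dmul K n (dexp c) d (pure_tensor (fun s => divpow (v s) (dexp c s))).
Proof.
apply/ffunP => m; rewrite ffunE sum_ffunE.
pose G (E : {ffun 'I_n -> {ffun 'I_n -> 'I_d.+1}}) : K :=
  \prod_j (((dexp m j)`! %/ \prod_s (E j s)`!)%:R * \prod_s (x s * v s 0 j) ^+ E j s).
transitivity (\sum_(E : {ffun 'I_n -> {ffun 'I_n -> 'I_d.+1}} | [forall j, (\sum_s E j s)%N == dexp m j]) G E).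
  rewrite -big_Dbasis => [|i]; last exact: dexp_le.
  under eq_bigr do rewrite summxE.
  under eq_bigr do (under eq_bigr do rewrite mxE); under eq_bigr do rewrite multinomial.
  rewrite bigA_distr_tbasis; apply: eq_bigr => Q _; apply: eq_bigr => j _.
  have e s : exp_mx d Q j s = dexp (Q j) s :> nat by apply: exp_mxE; apply: dexp_le.
  congr (_ * _); last by apply: eq_bigr => s _; rewrite e.
  by congr (_ %/ _)%:R; apply: eq_bigr => s _; rewrite e.
pose tr (E : {ffun 'I_n -> {ffun 'I_n -> 'I_d.+1}}) :=
  [ffun s => [ffun j => E j s]] : {ffun 'I_n -> {ffun 'I_n -> 'I_d.+1}}.
have trK : involutive tr by move=> E; apply/ffunP=> s; apply/ffunP=> j; rewrite !ffunE.
have trE E j s : tr E j s = E s j by rewrite !ffunE.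
rewrite (reindex_inj (inv_inj trK)) /=.
pose H (E : {ffun 'I_n -> {ffun 'I_n -> 'I_d.+1}}) : K :=
  if [forall j, (\sum_s E s j)%N == dexp m j] then G (tr E) else 0.
transitivity (\sum_(c : dbasis n d)
   \sum_(E : {ffun 'I_n -> {ffun 'I_n -> 'I_d.+1}} | [forall s, (\sum_j E s j)%N == dexp c s]) H E);
    last first.
  apply: eq_bigr => c _; rewrite -big_Dbasis => [|i]; last exact: dexp_le.
  rewrite ffunE Dmul_divpow scale_regE big_distrr [RHS]big_mkcond /=.
  apply: eq_bigr => P _; rewrite /H.
  have e s j : exp_mx d P s j = dexp (P s) j :> nat by apply: exp_mxE; apply: dexp_le.
  rewrite (_ : [forall j, _] = exp_sum P m); last first.
    by apply: eq_forallb => j; congr (_ == _); apply: eq_bigr => s _; rewrite e.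
  case: ifP => // _; rewrite /G big_split /= mulrA mulrC; congr (_ * _); last first.
    rewrite -natr_prod; congr _%:R; apply: eq_bigr => j _; congr (_ %/ _)%N.
    by apply: eq_bigr => s _; rewrite trE e.
  rewrite exchange_big -big_split /=; apply: eq_bigr => s _.
  have -> : x s ^+ dexp c s = \prod_j x s ^+ dexp (P s) j by rewrite prodrXr dexp_sum.
  rewrite -big_split /=; apply: eq_bigr => j _.
  by rewrite exprMn trE e.
rewrite (exchange_big_dep predT) //= big_mkcond /=; apply: eq_bigr => E _.
have -> : [forall j, (\sum_s tr E j s)%N == dexp m j] = [forall j, (\sum_s E s j)%N == dexp m j].
  by apply: eq_forallb => j; congr (_ == _); apply: eq_bigr => s _; rewrite trE.
rewrite /H; case: ifP => [sE|_]; last by rewrite big1.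
have sc : (\sum_s \sum_j E s j)%N = d.
  rewrite exchange_big /= -[RHS](dexp_sum m); apply: eq_bigr => j _.
  by apply/eqP/(forallP sE).
rewrite (eq_bigl (fun c => [forall s, dexp c s == (\sum_j E s j)%N])).
  by rewrite (big_dbasis_exp _ _ sc).
by move=> c; apply: eq_forallb => s; rewrite eq_sym.
Qed.

Lemma Dcomul_divpow (I : finType) (c : I -> nat) d (v : 'rV[K]_n) :
  (\sum_i c i)%N = d ->
  Dcomul K n c d (divpow v d) = pure_tensor (fun i => divpow v (c i)).
Proof.
move=> sc; apply/ffunP => P; rewrite lin_extE sum_ffunE ffunE.
have sP : (\sum_j \sum_i dexp (P i) j)%N = d.
  by rewrite exchange_big /= -[RHS]sc; apply: eq_bigr => i _; rewrite dexp_sum.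
transitivity (\sum_(m : dbasis n d | [forall j, dexp m j == \sum_i dexp (P i) j]%N)
                divpow v d m); last first.
  rewrite (big_dbasis_exp _ _ sP) ffunE.
  under [RHS]eq_bigr do rewrite ffunE.
  by rewrite exchange_big; apply: eq_bigr => j _; rewrite dexp_mk prodrXr.
rewrite [RHS]big_mkcond; apply: eq_bigr => m _; rewrite free_scaleE sum_basis_vec.
rewrite (_ : [forall j, _] = exp_sum P m); last by apply: eq_forallb => j; rewrite eq_sym.
by case: ifP; rewrite ?mulr1 ?mulr0.
Qed.

Lemma DcomulV_divpow d (v : 'rV[K]_n) :
  DcomulV K n d (divpow v d) = [ffun w : word n d => \prod_j v 0 (w j)].
Proof.
apply/ffunP => w; rewrite lin_extE sum_ffunE ffunE prod_content.
transitivity (\sum_(m : dbasis n d | [forall l, dexp m l == content w l]%N)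
                divpow v d m); last first.
  by rewrite (big_dbasis_exp _ _ (content_sum w)) ffunE; apply: eq_bigr => l _; rewrite dexp_mk.
rewrite [RHS]big_mkcond; apply: eq_bigr => m _; rewrite free_scaleE sum_basis_vec.
rewrite (_ : [forall j, dexp m j == _] = [forall l, content w l == dexp m l]); last first.
  by apply: eq_forallb => j; rewrite eq_sym.
by case: ifP; rewrite ?mulr1 ?mulr0.
Qed.

End DividedPowers.

(** * Exterior powers *)

Section Exterior.
Variables (K : fieldType) (n : nat).

Lemma Lmul_pure b (M : 'M[K]_(b, n)) :
  Lmul K n b [ffun w : word n b => \prod_i M i (w i)] = wedge M.
Proof.
apply/ffunP => t; rewrite lin_extE sum_ffunE ffunE.
under eq_bigr do rewrite free_scaleE !ffunE /determinant big_distrr /=.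
rewrite exchange_big; apply: eq_bigr => s _.
pose F i l : K := M i l * (l == tnth (val t) (s i))%:R.
transitivity ((-1) ^+ s * \sum_(w : word n b) \prod_i F i (w i)).
  rewrite big_distrr; apply: eq_bigr => w _ /=; rewrite mulrCA big_split /=.
  congr (_ * (_ * _)); apply: eq_bigr => i _.
  by rewrite !mxE eqxx eq_sym.
rewrite -bigA_distr_bigA; congr (_ * _); apply: eq_bigr => i _.
rewrite (bigD1 (tnth (val t) (s i))) //= big1 => [|l /negPf ne]; last by rewrite /F ne mulr0.
by rewrite /F eqxx mulr1 addr0 mxE.
Qed.

Lemma lbasis_mono b (t : lbasis n b) : {mono tnth (val t) : i j / (i < j)%N}.
Proof.
have lt (i j : 'I_b) : (i < j)%N -> (tnth (val t) i < tnth (val t) j)%N.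
  have x0 : 'I_n := tnth (val t) i.
  rewrite !(tnth_nth x0) => ij.
  have := @sorted_ltn_nth _ ltn ltn_trans 0%N _ (valP t) i j.
  by rewrite !inE size_map size_tuple !(nth_map x0) ?size_tuple //; apply.
move=> i j; case: (ltngtP i j) => [/lt -> //|/lt|/val_inj ->]; last by rewrite ltnn.
by move=> gt; rewrite ltnNge (ltnW gt).
Qed.

Lemma lbasis_inj b (t : lbasis n b) : injective (tnth (val t)).
Proof.
move=> i j e; case: (ltngtP i j) => [lt|lt|/val_inj //].
  by move: lt; rewrite -(lbasis_mono t) e ltnn.
by move: lt; rewrite -(lbasis_mono t) e ltnn.
Qed.

Definition word_sort b (w : word n b) : b.-tuple 'I_n :=
  sort_tuple (fun x y : 'I_n => (x <= y)%N) [tuple w i | i < b].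

Lemma word_sort_lbasis b (w : word n b) : injective w ->
  sorted ltn (map val (word_sort w)).
Proof.
move=> wi; rewrite ltn_sorted_uniq_leq (map_inj_uniq val_inj) sort_uniq.
rewrite map_inj_uniq ?enum_uniq //= sorted_map.
by apply: (sort_sorted (leT := relpre val leq)) => x y; apply: leq_total.
Qed.

Lemma mem_word_sort b (w : word n b) x : (x \in word_sort w) = (x \in codom w).
Proof.
by rewrite mem_sort.
Qed.

Lemma det_rowsub_noninj b (w : 'I_b -> 'I_n) (B : 'M[K]_(n, b)) :
  ~~ injectiveb w -> \det (rowsub w B) = 0.
Proof.
move/injectivePn => [i [j ne e]]; apply: (determinant_alternate ne) => l.
by rewrite !mxE e.
Qed.

(** Needed because [Lact] is given on basis wedges while the coordinates of [wedge] are minors.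
    Expanding M gives a sum over words: a repeated letter gives equal rows, and the injective words
    with given letters are the permutations of their increasing arrangement [t]. *)
Lemma Cauchy_Binet b (M : 'M[K]_(b, n)) (B : 'M[K]_(n, b)) :
  \det (M *m B) = \sum_(t : lbasis n b)
    \det (colsub (tnth (val t)) M) * \det (rowsub (tnth (val t)) B).
Proof.
transitivity (\sum_(w : word n b) (\prod_i M i (w i)) * \det (rowsub w B)).
  rewrite /determinant; under [RHS]eq_bigr do rewrite big_distrr /=.
  rewrite exchange_big; apply: eq_bigr => s _ /=.
  under eq_bigr do rewrite mxE.
  rewrite bigA_distr_bigA big_distrr; apply: eq_bigr => w _ /=.
  rewrite mulrCA big_split /=; congr (_ * (_ * _)); apply: eq_bigr => i _.
  by rewrite !mxE.
rewrite (bigID (fun w : word n b => injectiveb w)) /= [X in _ + X]big1 ?addr0; last first.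
  by move=> w ni; rewrite det_rowsub_noninj ?mulr0.
pose so (w : word n b) : option (lbasis n b) := insub (word_sort w).
transitivity (\sum_(t : lbasis n b) \sum_(w : word n b | injectiveb w && (so w == Some t))
   (\prod_i M i (w i)) * \det (rowsub w B)).
  rewrite (exchange_big_dep (fun w : word n b => injectiveb w)) /=; last by move=> ? ? _ /andP [].
  apply: eq_bigr => w iw; rewrite iw /=.
  have sw := word_sort_lbasis (injectiveP _ iw).
  rewrite (big_pred1 (Sub (word_sort w) sw : lbasis n b)) // => t.
  by rewrite /so insubT /= eq_sym; apply/eqP/eqP => [[]|->].
apply: eq_bigr => t _.
pose T := tnth (val t).
have Tinj : injective T := @lbasis_inj b t.
(* Permutations parametrize the words that sort to [t]. [h0] finds the position in [t] of each
   letter; its default, and the identity in [h'], only concern words outside this fibre. *)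
pose h (s : 'S_b) : word n b := [ffun i => T (s i)].
pose h0 (w : word n b) (i : 'I_b) : 'I_b := odflt i [pick j | T j == w i].
pose h' (w : word n b) : 'S_b :=
  if injectiveP (h0 w) is ReflectT inj then perm inj else 1%g.
have h0h s i : h0 (h s) i = s i.
  rewrite /h0 ffunE; case: pickP => [j /eqP /Tinj -> //|/(_ (s i))].
  by rewrite eqxx.
have h'h s : h' (h s) = s.
  rewrite /h'; case: injectiveP => [inj|[]].
    by apply/permP => i; rewrite permE h0h.
  by move=> i j; rewrite !h0h; apply: perm_inj.
have so_h s : so (h s) = Some t.
  have hi : injective (h s) by move=> i j; rewrite !ffunE => /Tinj /perm_inj.
  rewrite /so insubT; first exact: word_sort_lbasis.
  move=> sw; congr Some; apply: val_inj; apply: val_inj => /=.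
  apply: (@irr_sorted_eq _ (relpre val ltn)).
  - by move=> x y z; apply: ltn_trans.
  - by move=> x; apply: ltnn.
  - by rewrite -sorted_map.
  - by rewrite -sorted_map; apply: (valP t).
  move=> x; rewrite -/(val (word_sort (h s))) mem_word_sort.
  apply/codomP/tnthP => [[i ->]|[i ->]]; first by exists (s i); rewrite ffunE.
  by exists ((s^-1)%g i); rewrite ffunE permKV.
have hh' (w : word n b) : injectiveb w && (so w == Some t) -> h (h' w) = w.
  case/andP => /injectiveP wi; rewrite /so insubT; first exact: word_sort_lbasis.
  move=> sw /eqP [] /(congr1 val) /= et.
  have Th0 i : T (h0 w i) = w i.
    rewrite /h0; case: pickP => [j /eqP //|none].
    have : w i \in sval t by rewrite -et mem_word_sort codom_f.
    by case/tnthP => j e; have := none j; rewrite [w i]e eqxx.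
  have h0i : injective (h0 w) by move=> i j e; apply: wi; rewrite -!Th0 e.
  rewrite /h'; case: injectiveP => // inj.
  by apply/ffunP => i; rewrite ffunE permE Th0.
rewrite (reindex_onto h h') //= [X in X * _]/determinant big_distrl /=.
rewrite (eq_bigl predT) => [|s]; last first.
  rewrite so_h h'h !eqxx !andbT; apply/injectiveP => i j.
  by rewrite !ffunE => /Tinj /perm_inj.
apply: eq_bigr => s _.
have -> : rowsub (h s) B = row_perm s (rowsub T B).
  by apply/matrixP => i j; rewrite !mxE ffunE.
rewrite row_permE det_mulmx det_perm mulrCA mulrA; congr (_ * _ * _).
by apply: eq_bigr => i _; rewrite ffunE mxE.
Qed.

Lemma Lact_wedge b (g : 'M[K]_n) (M : 'M[K]_(b, n)) :
  Lact b g (wedge M) = wedge (M *m g^T).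
Proof.
apply/ffunP => u; rewrite lin_extE sum_ffunE [RHS]ffunE.
have -> : colsub (tnth (val u)) (M *m g^T) = M *m colsub (tnth (val u)) g^T.
  by apply/matrixP => i j; rewrite !mxE; apply: eq_bigr => l _; rewrite !mxE.
rewrite Cauchy_Binet; apply: eq_bigr => t _; rewrite free_scaleE !ffunE.
by congr (_ * \det _); apply/matrixP => i j; rewrite !mxE.
Qed.

Lemma Dact_divpow d (g : 'M[K]_n) (v : 'rV[K]_n) :
  Dact d g (divpow v d) = divpow (v *m g^T) d.
Proof.
have -> : v *m g^T = \sum_s v 0 s *: gvec g s.
  by apply/rowP => j; rewrite mxE summxE; apply: eq_bigr => s _; rewrite !mxE.
by rewrite divpow_sum lin_extE; apply: eq_bigr => c _; rewrite ffunE.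
Qed.

Lemma Dtens_act_divpow (I : finType) (c : I -> nat) (g : 'M[K]_n) (v : I -> 'rV[K]_n) :
  Dtens_act c g (pure_tensor (fun i => divpow (v i) (c i))) =
  pure_tensor (fun i => divpow (v i *m g^T) (c i)).
Proof. by rewrite tensor_map_pure; apply: eq_pure_tensor => i; apply: Dact_divpow. Qed.

Lemma Ltens_act_wedge (I : finType) (b : I -> nat) (g : 'M[K]_n)
    (M : forall i, 'M[K]_(b i, n)) :
  Ltens_act b g (pure_tensor (fun i => wedge (M i))) =
  pure_tensor (fun i => wedge (M i *m g^T)).
Proof. by rewrite tensor_map_pure; apply: eq_pure_tensor => i; apply: Lact_wedge. Qed.

Section Shape.
Variables (k : nat) (a : 'I_k -> nat).

Lemma le_ncols i : (a i <= ncols a)%N. Proof. exact: leq_bigmax. Qed.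

Lemma col_row_inj (j : 'I_(ncols a)) : injective (@col_row k a j).
Proof. exact: enum_val_inj. Qed.

Lemma mem_col (j : 'I_(ncols a)) i : (j < a i)%N -> i \in col (a:=a) j.
Proof. by rewrite inE. Qed.

Lemma col_row_surj (j : 'I_(ncols a)) i : (j < a i)%N -> exists i' : 'I_(transp j), col_row i' = i.
Proof.
move=> ji; exists (enum_rank_in (mem_col ji) i).
by rewrite /col_row enum_rankK_in // mem_col.
Qed.

Lemma col_row_mono (j : 'I_(ncols a)) (i i' : 'I_(transp j)) :
  (i < i')%N -> (col_row i < col_row i')%N.
Proof.
move=> lt; have x0 := col_row i.
rewrite /col_row !(enum_val_nth x0).
have srt : sorted ltn (map val (enum (col j))).
  rewrite /enum_mem sorted_map.
  apply: sorted_filter; first by move=> x y z; apply: ltn_trans.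
  by rewrite -enumT -sorted_map val_enum_ord iota_ltn_sorted.
have := @sorted_ltn_nth _ ltn ltn_trans 0%N _ srt i i'.
by rewrite !inE size_map -!cardE !(nth_map x0) -?cardE ?ltn_ord //; apply.
Qed.

Definition row_box (q : {j : 'I_(ncols a) & 'I_(transp j)}) : {i : 'I_k & 'I_(a i)} :=
  Tagged (fun i => 'I_(a i)) (Ordinal (col_rowP (tagged q))).

Definition col_box (p : {i : 'I_k & 'I_(a i)}) : {j : 'I_(ncols a) & 'I_(transp j)} :=
  let j := widen_ord (le_ncols (tag p)) (tagged p) in
  Tagged (fun j : 'I_(ncols a) => 'I_(transp j))
    (enum_rank_in (@mem_col j (tag p) (ltn_ord (tagged p))) (tag p)).

Lemma eq_Tagged_ord (I : Type) (f : I -> nat) (p q : {i : I & 'I_(f i)}) :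
  tag p = tag q -> tagged p = tagged q :> nat -> p = q.
Proof.
case: p q => [i x] [j y] /= e; rewrite -{j}e in y *.
by move/val_inj->.
Qed.

Lemma col_boxK : cancel col_box row_box.
Proof.
case=> i l; apply: eq_Tagged_ord => //=.
by rewrite /col_row enum_rankK_in // mem_col //= ltn_ord.
Qed.

Lemma row_boxK : cancel row_box col_box.
Proof.
case=> j i; apply: eq_Tagged_ord => /=; first exact: val_inj.
(* The column of [row_box q] equals j only propositionally, so it is generalized before being
   substituted. *)
have : forall j' (e : j' = j) (x0 : 'I_k) (x0P : x0 \in col (a:=a) j'),
  enum_rank_in x0P (col_row i) = i :> nat.
  by move=> j' -> x0 x0P; rewrite /col_row enum_valK_in.
by apply; apply: val_inj.
Qed.

Lemma big_boxes (R : Type) (idx : R) (op : Monoid.com_law idx)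
    (F : forall i, 'I_(a i) -> R) :
  \big[op/idx]_i \big[op/idx]_(l < a i) F i l =
  \big[op/idx]_(j < ncols a) \big[op/idx]_(i < transp j)
     F (col_row i) (Ordinal (col_rowP i)).
Proof.
rewrite !sig_big_dep /= (reindex row_box) //.
exact/onW_bij/(Bijective row_boxK col_boxK).
Qed.

Definition by_rows (C : tbasis (fun j : 'I_(ncols a) => word n (transp j))) :
    filling n a :=
  [ffun i => [ffun l : 'I_(a i) =>
     let q := col_box (Tagged (fun i => 'I_(a i)) l) in C (tag q) (tagged q)]].

Lemma by_columns_box (T : filling n a) q :
  by_columns T (tag q) (tagged q) = T (tag (row_box q)) (tagged (row_box q)).
Proof. by rewrite !ffunE. Qed.

Lemma by_columnsK : cancel (@by_columns n k a) by_rows.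
Proof.
move=> T; apply/ffunP => i; apply/ffunP => l.
rewrite ffunE ffunE.
by have := by_columns_box T (col_box (Tagged (fun i => 'I_(a i)) l)); rewrite col_boxK.
Qed.

Lemma by_rowsK : cancel by_rows (@by_columns n k a).
Proof.
move=> C; apply/ffunP => j; apply/ffunP => i.
pose q := Tagged (fun j : 'I_(ncols a) => 'I_(transp j)) i.
rewrite (by_columns_box (by_rows C) q) ffunE ffunE.
by have := row_boxK q; rewrite -[Tagged _ (tagged (row_box q))]/(row_box q) => ->.
Qed.

(** Full comultiplication turns u^(d) into a tensor power of u, so every box of row i carries [u i];
    regrouping the boxes by columns then only reorders a product of scalars. *)
Lemma dprime_divpow (u : 'I_k -> 'rV[K]_n) :
  dprime K n a (pure_tensor (fun i => divpow (u i) (a i))) =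
  pure_tensor (fun j => wedge (\matrix_(i < transp (a := a) j) u (col_row i))).
Proof.
rewrite /dprime !comp_lfunE tensor_map_pure.
rewrite (eq_pure_tensor (fun i => DcomulV_divpow (a i) (u i))).
rewrite -(eq_pure_tensor (fun j => Lmul_pure (\matrix_(i < transp (a := a) j) u (col_row i)))).
rewrite -tensor_map_pure; congr (tensor_map _ _); apply/ffunP => C.
rewrite (relabelE _ _ by_columnsK by_rowsK) !ffunE.
under eq_bigr do rewrite ffunE.
rewrite big_boxes; apply: eq_bigr => j _; rewrite ffunE; apply: eq_bigr => i _.
by rewrite mxE -[in RHS](by_rowsK C) !ffunE.
Qed.

End Shape.
End Exterior.

(** * Straightening *)

Section Straightening.
Variables (K : fieldType) (n : nat) (la : 'I_n -> nat).
Hypothesis K_infinite : forall s : seq K, exists x : K, x \notin s.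

Definition mx_monom (A : Dbasis n la) (X : 'M[K]_n) : K :=
  \prod_i \prod_j X i j ^+ dexp (A i) j.

Lemma pure_divpow_expand (X : 'M[K]_n) :
  pure_tensor (fun i => divpow (row i X) (la i)) =
  \sum_A mx_monom A X *: basis_vec K A.
Proof.
rewrite [LHS]free_mod_expand; apply: eq_bigr => A _; congr (_ *: _).
rewrite ffunE; apply: eq_bigr => i _; rewrite ffunE.
by apply: eq_bigr => j _; rewrite mxE.
Qed.

(* In terms of exponents, a filling with weakly increasing rows has strictly
   increasing columns iff row i + 1 never has more entries <= c than row i has
   entries < c. *)
Definition std_exp (A : Dbasis n la) : bool :=
  [forall i : 'I_n, forall i' : 'I_n, (i' == i.+1 :> nat) ==>
    [forall c : 'I_n, \sum_(l < n | l <= c) dexp (A i') l <=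
                      \sum_(l < n | l < c) dexp (A i) l]%N].

Definition row_weight (e : 'I_n -> nat) : nat := (\sum_(l < n) l * e l)%N.

(** The sum over all boxes of row index times letter, which grows as large letters move to rows
    further down. It orders the arguments for both straightening and independence. *)
Definition weight (A : Dbasis n la) : nat := (\sum_(i < n) i * row_weight (dexp (A i)))%N.

Definition add_row (i i' : 'I_n) (t : K) (X : 'M[K]_n) : 'M[K]_n :=
  \matrix_(k, l) (if k == i' then X k l + t * X i l else X k l).

(** Each (l - c)(e l - e' l) is nonnegative, and since the totals agree these terms add up to the
    difference of the weights, which is at most 0; so all of them vanish. [le] expresses this
    without subtraction. *)
Lemma row_weight_eq (e e' : 'I_n -> nat) (c : 'I_n) :
  (\sum_l e l = \sum_l e' l)%N -> (row_weight e <= row_weight e')%N ->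
  (forall l : 'I_n, l < c -> e l <= e' l)%N ->
  (forall l : 'I_n, c < l -> e' l <= e l)%N -> e =1 e'.
Proof.
move=> se we lo hi.
have le (l : 'I_n) : (l * e' l + c * e l <= l * e l + c * e' l
             ?= iff (l * e' l + c * e l == l * e l + c * e' l))%N.
  split=> //; have := lo l; have := hi l; case: (ltngtP l c) => [lt|lt|/val_inj ->]; last lia.
  - by move=> _ /(_ isT) ?; nia.
  - by move=> /(_ isT) ? _; nia.
have [] := leqif_sum (fun l (_ : true) => le l).
rewrite !big_split /= -!big_distrr /= se => le1 /esym.
have -> : (\sum_(i < n) i * e' i + c * \sum_i e' i == \sum_(i < n) i * e i + c * \sum_i e' i)%N.
  by rewrite eqn_leq le1 leq_add2r.
move/forallP => eql.
have ne (l : 'I_n) : l != c -> e l = e' l.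
  move=> lc; have /= /eqP := eql l; have : (l != c :> nat) by [].
  nia.
move=> l; have [->|/ne //] := eqVneq l c.
move: se; rewrite (bigD1 c) //= [in RHS](bigD1 c) //= (eq_bigr e') => [|j /ne //].
by move/addIn.
Qed.

(* If the counting condition fails for rows i, i' = i + 1 and the letter c, scale by
   eps the part of row i on letters < c and the part of row i' on letters > c, and
   add a common generic vector b to both rows.  Subtracting row i from row i'
   shows that the value of f is divisible by eps^(la i'), whereas the monomial
   indexed by A0 has a smaller degree in eps.  Any other A contributing to this
   monomial is obtained from A0 by moving smaller letters to row i, which
   increases the weight.  J indexes the entries scaled by eps, the entries of b
   and the entries of the other rows. *)
Section Violation.
Variables (f : Dbasis n la -> K) (A0 : Dbasis n la) (i i' c : 'I_n).
Hypothesis ii' : i' = i.+1 :> nat.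
Hypothesis inv : forall X, \sum_A f A * mx_monom A (add_row i i' 1 X) =
                           \sum_A f A * mx_monom A X.
Hypothesis f_max : forall A, f A != 0 -> (weight A <= weight A0)%N.
Hypothesis viol : (\sum_(l < n | l < c) dexp (A0 i) l < \sum_(l < n | l <= c) dexp (A0 i') l)%N.

Let S (q : 'I_n * 'I_n) : bool := (q.1 == i) && (q.2 < c)%N || (q.1 == i') && (c < q.2)%N.
Let N := (\max_k la k)%N.
Let J : finType := (('I_n * 'I_n) + 'I_n + ('I_n * 'I_n))%type.
Let two k := (k == i) || (k == i').
Let H0 (q : 'I_n * 'I_n) : nat := if S q then dexp (A0 q.1) q.2 else 0%N.

(** Exponents, in the variables J, of the term of the expanded A-monomial that takes the scaled part
    of entry q exactly [H q] times. Rows i and i' share the vector b, so only the sum of their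
    remaining exponents is visible. [H0] takes the scaled part at every entry that has one. *)
Let ex (A : Dbasis n la) (H : 'I_n * 'I_n -> nat) (j : J) : nat :=
  match j with
  | inl (inl q) => H q
  | inl (inr l) => \sum_(k | two k) (dexp (A k) l - H (k, l))
  | inr q => if two q.1 then 0 else dexp (A q.1) q.2 - H q
  end%N.

Let ne_ii' : i != i'. Proof. by apply/eqP => e; move: ii'; rewrite e; lia. Qed.

Lemma big_two (R : Type) (idx : R) (op : Monoid.com_law idx) (F : 'I_n -> R) :
  \big[op/idx]_(k | two k) F k = op (F i) (F i').
Proof.
rewrite (bigD1 i) /=; last by rewrite /two eqxx.
rewrite (big_pred1 i') // => k; rewrite /two /=.
by case: (eqVneq k i) => [->|_]; rewrite ?andbT ?andbF //= (negPf ne_ii').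
Qed.

Lemma ex_unique (A : Dbasis n la) (H : 'I_n * 'I_n -> nat) :
  (forall q, H q <= dexp (A q.1) q.2)%N -> (weight A <= weight A0)%N ->
  (forall j, ex A H j = ex A0 H0 j) -> H =1 H0 /\ A = A0.
Proof.
move=> leH leW e.
have eH q : H q = H0 q := e (inl (inl q)).
split=> //.
have two_i : two i by rewrite /two eqxx.
have two_i' : two i' by rewrite /two eqxx orbT.
have other k l : ~~ two k -> dexp (A k) l = dexp (A0 k) l.
  move=> nk; have := e (inr (k, l)); rewrite /= (negPf nk) eH.
  have -> : H0 (k, l) = 0%N.
    by move: nk; rewrite /H0 /S /two /= negb_or => /andP [/negPf -> /negPf ->].
  by rewrite !subn0.
have lo (l : 'I_n) : (l < c)%N -> (dexp (A0 i) l <= dexp (A i) l)%N.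
  by move=> lc; have := leH (i, l); rewrite eH /H0 /S /= eqxx lc.
have hi (l : 'I_n) : (c < l)%N -> (dexp (A0 i') l <= dexp (A i') l)%N.
  by move=> lc; have := leH (i', l); rewrite eH /H0 /S /= eqxx lc orbT.
have both l : (dexp (A i) l + dexp (A i') l = dexp (A0 i) l + dexp (A0 i') l)%N.
  have := e (inl (inr l)); rewrite /= !big_two -!eH.
  have := leH (i, l); have := leH (i', l); rewrite /=.
  have : (H (i, l) <= dexp (A0 i) l)%N by rewrite eH /H0; case: ifP.
  have : (H (i', l) <= dexp (A0 i') l)%N by rewrite eH /H0; case: ifP.
  move=> /= h1 h2 h3 h4 h5. lia.
have wboth : (row_weight (dexp (A i)) + row_weight (dexp (A i')) =
              row_weight (dexp (A0 i)) + row_weight (dexp (A0 i')))%N.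
  rewrite /row_weight -!big_split; apply: eq_bigr => l _ /=.
  by rewrite -!mulnDr both.
(* Rows i and i + 1 enter the weight with factors j and j + 1 and have a fixed joint row weight; a
   total weight not above that of A0 therefore forces at least as much row weight into row i. *)
have aux a b a' b' j : (a + b = a' + b' -> j * a + j.+1 * b <= j * a' + j.+1 * b' -> a' <= a)%N.
  by rewrite !mulSn => h; have := congr1 (muln j) h; rewrite !mulnDr; lia.
have wle : (row_weight (dexp (A0 i)) <= row_weight (dexp (A i)))%N.
  move: leW; rewrite /weight (bigID two) [X in (_ <= X)%N -> _](bigID two) /=.
  rewrite [X in (_ + X <= _)%N](eq_bigr (fun k : 'I_n => k * row_weight (dexp (A0 k)))%N); last first.
    by move=> k nk; congr (_ * _)%N; apply: eq_bigr => l _; rewrite other.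
  rewrite leq_add2r !big_two ii'; exact: aux wboth.
have ei : dexp (A0 i) =1 dexp (A i).
  apply: (row_weight_eq (c := c)) => //; first by rewrite !dexp_sum.
  by move=> l lc; have := hi l lc; have := both l; lia.
apply: Dbasis_inj => k l; case: (boolP (two k)) => [/orP [] /eqP ->|]; last exact: other.
  by rewrite ei.
by have := both l; rewrite ei => /addnI.
Qed.

(** Row i' has [la i'] entries in all; here its entries <= c are replaced by the entries < c of row
    i, which are fewer by [viol]. *)
Lemma sum_H0 : (\sum_q H0 q < la i')%N.
Proof.
rewrite -(pair_bigA _ (fun k l => H0 (k, l))) /= (bigID two) /= [X in (_ + X)%N]big1 ?addn0; last first.
  move=> k; rewrite /two negb_or => /andP [/negPf k1 /negPf k2].
  by apply: big1 => l _; rewrite /H0 /S /= k1 k2.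
rewrite big_two /= -[X in (_ < X)%N](dexp_sum (A0 i'))
  [X in (_ < X)%N](bigID (fun l : 'I_n => l <= c)%N) /=.
have -> : (\sum_l H0 (i, l) = \sum_(l < n | l < c) dexp (A0 i) l)%N.
  rewrite [RHS]big_mkcond; apply: eq_bigr => l _.
  by rewrite /H0 /S /= eqxx (negPf ne_ii') /= orbF.
have -> : (\sum_l H0 (i', l) = \sum_(l < n | ~~ (l <= c)) dexp (A0 i') l)%N.
  rewrite [RHS]big_mkcond; apply: eq_bigr => l _.
  by rewrite /H0 /S /= eqxx eq_sym (negPf ne_ii') /= -ltnNge.
by rewrite ltn_add2r.
Qed.

Section Degenerate.
Variable s : J -> K.

Let Q (q : 'I_n * 'I_n) : K := if two q.1 then s (inl (inr q.2)) else s (inr q).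
Let P (q : 'I_n * 'I_n) : K := if S q then s (inl (inl q)) else 0.

Definition poly_monom (A : Dbasis n la) (M : 'I_n -> 'I_n -> {poly K}) : {poly K} :=
  \prod_k \prod_l M k l ^+ dexp (A k) l.

Lemma horner_poly_monom A M e :
  (poly_monom A M).[e] = mx_monom A (\matrix_(k, l) (M k l).[e]).
Proof.
rewrite horner_prod; apply: eq_bigr => k _; rewrite horner_prod.
by apply: eq_bigr => l _; rewrite horner_exp mxE.
Qed.

Lemma exprDn_widen (R : comPzRingType) (x y : R) d e : (e <= d)%N ->
  (x + y) ^+ e = \sum_(h < d.+1) (x ^+ (e - h) * y ^+ h) *+ 'C(e, h).
Proof.
move=> led; rewrite exprDn (big_ord_widen d.+1 (fun h => (x ^+ (e - h) * y ^+ h) *+ 'C(e, h))) //.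
rewrite big_mkcond; apply: eq_bigr => h _; case: ltnP => // lt.
by rewrite bin_small.
Qed.

(** [ML] arises from [MR] by adding row i to row i': the common vector b cancels in row i' of [MR],
    which is left as a multiple of the variable. *)
Let ML k l : {poly K} := (Q (k, l))%:P + P (k, l) *: 'X.
Let MR k l : {poly K} := if k == i' then (P (i', l) - P (i, l)) *: 'X else ML k l.

Lemma degenerate_poly : \sum_A f A *: poly_monom A ML = \sum_A f A *: poly_monom A MR.
Proof.
apply: (poly_fun_ext K_infinite) => e; rewrite !horner_sum.
have E M : \sum_A (f A *: poly_monom A M).[e] =
  \sum_A f A * mx_monom A (\matrix_(k, l) (M k l).[e]).
  by apply: eq_bigr => A _; rewrite hornerZ horner_poly_monom.
rewrite !E -[RHS]inv; apply: eq_bigr => A _; congr (_ * mx_monom A _).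
apply/matrixP => k l; rewrite !mxE /MR (negPf ne_ii'); case: eqP => [->|//].
rewrite mul1r /ML !(hornerE, hornerZ) /= /Q /two /= !eqxx orbT /=.
by ring.
Qed.

Lemma degenerate_coef t : (t < la i')%N -> (\sum_A f A *: poly_monom A ML)`_t = 0.
Proof.
move=> lt; rewrite degenerate_poly coef_sum big1 // => A _.
rewrite coefZ /poly_monom (bigD1 i') //= /MR eqxx.
under eq_bigr do rewrite exprZn.
rewrite scaler_prod prodrXr dexp_sum -scalerAl coefZ coefXnM lt.
by rewrite !mulr0.
Qed.

(** The factor [(S q)%:R ^+ H q] kills the terms that take a scaled part at an unscaled entry and,
    as 0 ^+ 0 = 1, lets the others through. *)
Lemma poly_monom_expand A : poly_monom A ML =
  \sum_(H : {ffun 'I_n * 'I_n -> 'I_N.+1})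
    (\prod_q ('C(dexp (A q.1) q.2, H q)%:R * (S q)%:R ^+ H q) *
       monom s (ex A (fun q => H q))) *: 'X^(\sum_q H q).
Proof.
rewrite /poly_monom pair_bigA /=.
pose G (q : 'I_n * 'I_n) (h : 'I_N.+1) : {poly K} :=
  ('C(dexp (A q.1) q.2, h)%:R * (S q)%:R ^+ h * (Q q ^+ (dexp (A q.1) q.2 - h) *
   s (inl (inl q)) ^+ h)) *: 'X^h.
transitivity (\prod_q \sum_h G q h).
  apply: eq_bigr => -[k l] _ /=; rewrite /ML (@exprDn_widen _ _ _ N).
    apply: eq_bigr => h _; rewrite /G exprZn -rmorphXn /= mul_polyC scalerA -scaler_nat scalerA.
    congr (_ *: _); rewrite -!mulrA; congr (_ * _); rewrite mulrCA; congr (_ * _).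
    by rewrite /P; case: (S _); rewrite ?expr1n ?mul1r // -exprMn mul0r.
  by rewrite (leq_trans (dexp_le _ _)) // leq_bigmax.
rewrite bigA_distr_bigA; apply: eq_bigr => H _.
rewrite scaler_prod prodrXr; congr (_ *: _); rewrite big_split /=; congr (_ * _).
rewrite /monom !big_sumType /= big_split /= mulrC -mulrA; congr (_ * _).
have pairE (F : 'I_n * 'I_n -> K) : \prod_q F q = \prod_k \prod_l F (k, l).
  by rewrite pair_bigA; apply: eq_bigr => -[].
rewrite pairE [X in _ = _ * X]pairE /=.
rewrite (bigID two) /=; congr (_ * _).
  rewrite exchange_big; apply: eq_bigr => l _; rewrite -prodrXr.
  by apply: eq_bigr => k tk; rewrite /Q /= tk.
rewrite [RHS](bigID two) /= [X in _ = X * _]big1 ?mul1r => [|k tk].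
  apply: eq_bigr => k /negPf tk; apply: eq_bigr => l _.
  by rewrite /Q /= tk.
by apply: big1 => l _; rewrite tk expr0.
Qed.

End Degenerate.

Lemma violation_coef0 : f A0 = 0.
Proof.
pose t := (\sum_q H0 q)%N.
pose B : finType := (Dbasis n la * {ffun 'I_n * 'I_n -> 'I_N.+1})%type.
pose co (b : B) : K := f b.1 * \prod_q ('C(dexp (b.1 q.1) q.2, b.2 q)%:R * (S q)%:R ^+ b.2 q) *
  (t == \sum_q b.2 q)%N%:R.
pose ee (b : B) : J -> nat := ex b.1 (fun q => b.2 q).
have vanish (s : J -> K) : \sum_b co b * monom s (ee b) = 0.
  rewrite -[RHS](degenerate_coef s sum_H0) coef_sum.
  rewrite -(pair_bigA _ (fun A H => co (A, H) * monom s (ee (A, H)))) /=.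
  apply: eq_bigr => A _; rewrite poly_monom_expand coefZ coef_sum big_distrr /=.
  apply: eq_bigr => H _; rewrite coefZ coefXn /co /ee /= -!mulrA; congr (_ * _).
  by ring.
have leH0 q : (H0 q <= N)%N.
  rewrite /H0; case: ifP => // _.
  by rewrite (leq_trans (dexp_le _ _)) // leq_bigmax.
pose b0 : B := (A0, [ffun q => inord (H0 q)]).
have b0E q : b0.2 q = H0 q :> nat by rewrite ffunE inordK // ltnS.
have := monom_indep K_infinite (ee b0) vanish.
rewrite (bigD1 b0) /=; last by apply/forallP.
rewrite [X in _ + X]big1 ?addr0 => [|[A H] /andP [/forallP eE ne]].
  (* At [b0] every binomial is C(e, e) or C(e, 0), so the surviving coefficient is [f A0] itself,
     whatever the characteristic. *)
  rewrite /co /= [X in _ * X * _]big1 => [|q _].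
    rewrite mulr1; have -> : (t == \sum_q b0.2 q)%N; last by rewrite mulr1.
    by apply/eqP/eq_bigr => q _; rewrite b0E.
  rewrite b0E /H0; case: ifP => [Sq|nSq]; first by rewrite binn expr1n mulr1.
  by rewrite bin0 expr0 mulr1.
apply/eqP; apply: contraNT ne; rewrite /co /= !mulf_eq0 !negb_or => /andP [/andP [fA CA] _].
have leH q : (H q <= dexp (A q.1) q.2)%N.
  rewrite leqNgt; apply: contraNN CA => lt.
  by rewrite (bigD1 q) //= bin_small // !mul0r.
have [j|HE ->] := ex_unique leH (f_max fA).
  rewrite -/(ee (A, H) j) (eqP (eE j)) /ee; move: j => [[q|l]|q] //=.
  - by apply: eq_bigr => k _; rewrite b0E.
  - by rewrite b0E.
apply/eqP; congr pair; apply/ffunP => q; apply: val_inj => /=.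
by rewrite b0E HE.
Qed.

End Violation.

(** An element of maximal weight in the support of f admits no violation, since [violation_coef0]
    would make its coefficient zero; it is then standard, where f vanishes. *)
Lemma straightening (f : Dbasis n la -> K) :
  (forall (i i' : 'I_n) X, i' = i.+1 :> nat ->
     \sum_A f A * mx_monom A (add_row i i' 1 X) = \sum_A f A * mx_monom A X) ->
  (forall A, std_exp A -> f A = 0) -> forall A, f A = 0.
Proof.
move=> inv std0 A; apply/eqP; apply: contraT => fA.
case: (@arg_maxnP _ A (fun A => f A != 0) weight fA) => A0 fA0 maxA0.
suff : std_exp A0 by move/std0 => e; rewrite e eqxx in fA0.
apply/forallP => i; apply/forallP => i'; apply/implyP => /eqP ii'; apply/forallP => c.
rewrite leqNgt; apply/negP => viol.
by move: fA0; rewrite (violation_coef0 ii' (fun X => inv i i' X ii') maxA0 viol) eqxx.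
Qed.

End Straightening.

(** * Sorted words and rearrangement *)

Section SortedWords.
Variable n : nat.

Definition cumul (e : 'I_n -> nat) (c : nat) : nat := (\sum_(l < n | l < c) e l)%N.

Lemma cumul_mono e c c' : (c <= c')%N -> (cumul e c <= cumul e c')%N.
Proof.
move=> le; rewrite /cumul big_mkcond [X in (_ <= X)%N]big_mkcond /=.
apply: leq_sum => l _; case: (ltnP l c) => // lt.
by rewrite (leq_trans lt le).
Qed.

Lemma cumulS e (l : 'I_n) : cumul e l.+1 = (cumul e l + e l)%N.
Proof.
rewrite /cumul (bigD1 l) //= addnC; congr (_ + _)%N; apply: eq_bigl => i.
by rewrite ltnS [RHS]ltn_neqAle andbC.
Qed.

Lemma cumul_full e : cumul e n = (\sum_l e l)%N.
Proof. by apply: eq_bigl => l; rewrite ltn_ord. Qed.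

Lemma cumul_inj e e' : (forall c : nat, cumul e c = cumul e' c) -> e =1 e'.
Proof. by move=> ec l; have := ec l.+1; rewrite !cumulS ec => /addnI. Qed.

Lemma eq_cumul e e' : e =1 e' -> cumul e =1 cumul e'.
Proof. by move=> ee c; apply: eq_bigr => l _. Qed.

Lemma card_ltn_ord d b : (b <= d)%N -> #|[set j : 'I_d | (j < b)%N]| = b.
Proof.
by move=> le; rewrite -sum1dep_card -(big_ord_widen _ (fun _ => 1%N) le) sum1_card card_ord.
Qed.

Lemma cumul_content d (w : word n d) c :
  cumul (content w) c = #|[set j | (w j < c)%N]|.
Proof.
rewrite -sum1dep_card (partition_big w (fun l : 'I_n => (l < c)%N)) //=.
apply: eq_bigr => l lc; rewrite /content -sum1dep_card; apply: eq_bigl => j.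
by case: eqP => [->|]; rewrite ?lc ?andbF.
Qed.

Definition sorted_word d (w : word n d) : Prop := forall j j' : 'I_d, (j <= j')%N -> (w j <= w j')%N.

(** The letters below c fill an initial segment of a sorted word, whose length is their number. *)
Lemma sorted_word_lt d (w : word n d) (j : 'I_d) c : sorted_word w ->
  (w j < c)%N = (j < cumul (content w) c)%N.
Proof.
move=> sw; rewrite cumul_content; case: (ltnP (w j) c) => wc; apply/esym.
  rewrite -(card_ltn_ord (ltn_ord j)) ?ltnS; apply: subset_leq_card.
  apply/subsetP => i; rewrite !inE ltnS => /sw le.
  exact: leq_ltn_trans le wc.
apply: negbTE; rewrite -leqNgt -[X in (_ <= X)%N](card_ltn_ord (ltnW (ltn_ord j))).
apply: subset_leq_card; apply/subsetP => i; rewrite !inE => ic.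
rewrite ltnNge; apply/negP => /sw; lia.
Qed.

Lemma sorted_word_inj d (w w' : word n d) : sorted_word w -> sorted_word w' ->
  content w =1 content w' -> w = w'.
Proof.
move=> sw sw' e; apply/ffunP => j; apply: val_inj.
have E c : (w j < c)%N = (w' j < c)%N by rewrite !sorted_word_lt // (eq_cumul e).
have := E (w j).+1; have := E (w' j).+1; rewrite !ltnSn /=; lia.
Qed.

Lemma sorted_word_ex (e : 'I_n -> nat) d : (\sum_l e l)%N = d ->
  exists w : word n d, sorted_word w /\ content w =1 e.
Proof.
move=> se.
have ex (j : 'I_d) : exists c, (j < cumul e c)%N.
  by exists n; rewrite cumul_full se.
(* [cumul] counts letters strictly below its argument, hence the predecessor; the minimum is
   positive because [cumul e 0] is 0. *)
pose w0 (j : 'I_d) := (ex_minn (ex j)).-1.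
have w0P j c : (w0 j < c)%N = (j < cumul e c)%N.
  rewrite /w0; case: ex_minnP => [[|m]] /=.
    by rewrite /cumul big_pred0.
  move=> h1 h2; apply/idP/idP => [le|/h2 //].
  exact: leq_trans h1 (cumul_mono _ le).
have w0n j : (w0 j < n)%N by rewrite w0P cumul_full se.
exists [ffun j => Ordinal (w0n j)]; split=> [j j' le|].
  rewrite !ffunE /= -ltnS w0P; apply: leq_ltn_trans le _.
  by rewrite -w0P.
apply: cumul_inj => c; rewrite cumul_content.
have led : (cumul e c <= d)%N.
  by rewrite -se /cumul [X in (_ <= X)%N](bigID (fun l : 'I_n => (l < c)%N)) /= leq_addr.
rewrite -[RHS](card_ltn_ord led); apply: eq_card => j; rewrite !inE ffunE /=.
exact: w0P.
Qed.

End SortedWords.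

(** * The rearrangement inequality with its equality case *)

Section Rearrangement.
Variables (b : nat) (f g : 'I_b -> nat).
Hypothesis f_mono : forall i j : 'I_b, (i < j)%N -> (f i < f j)%N.
Hypothesis g_mono : forall i j : 'I_b, (i < j)%N -> (g i < g j)%N.

Let V (s : 'S_b) : nat := (\sum_i f i * g (s i))%N.

Lemma increasing_perm_le (s : 'S_b) :
  (forall i j : 'I_b, (i < j)%N -> (s i < s j)%N) -> forall i : 'I_b, (i <= s i)%N.
Proof.
move=> incr [k]; elim: k => [//|k IHk] lt.
have := IHk (ltnW lt); have := incr (Ordinal (ltnW lt)) (Ordinal lt) (ltnSn k).
by move=> /= h1 h2; apply: leq_ltn_trans h1.
Qed.

Lemma increasing_perm_id (s : 'S_b) :
  (forall i j : 'I_b, (i < j)%N -> (s i < s j)%N) -> s = 1%g.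
Proof.
move=> incr; apply/permP => i; rewrite perm1; apply: val_inj; apply/eqP.
rewrite eqn_leq (increasing_perm_le incr) andbT.
have incrV (x y : 'I_b) : (x < y)%N -> ((s^-1)%g x < (s^-1)%g y)%N.
  move=> lt; case: (ltngtP ((s^-1)%g x) ((s^-1)%g y)) => [//|/incr|/val_inj e].
    by rewrite !permKV ltnNge (ltnW lt).
  by move: lt; rewrite -[x](permKV s) -[y](permKV s) e ltnn.
by have := increasing_perm_le incrV (s i); rewrite permK.
Qed.

(** A nonidentity permutation has an inversion, and undoing it raises the sum strictly as f and g
    are strictly increasing. Strictness is what later makes the leading term unique. *)
Lemma rearrangement_step (s : 'S_b) : s != 1%g -> exists s', (V s < V s')%N.
Proof.
move=> s1.
have /existsP [i /existsP [j /andP [ij ji]]] :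
    [exists i : 'I_b, exists j : 'I_b, (i < j)%N && (s j < s i)%N].
  apply: contraNT s1; rewrite negb_exists => /forallP H; apply/eqP/increasing_perm_id => i j lt.
  have := H i; rewrite negb_exists => /forallP /(_ j); rewrite lt /= -leqNgt leq_eqVlt.
  by case/orP => // /eqP /val_inj /perm_inj e; rewrite e ltnn in lt.
exists (tperm i j * s)%g; rewrite /V.
have ne : j != i by apply: contraTN ij => /eqP ->; rewrite ltnn.
rewrite (bigD1 i) //= (bigD1 j) //= [X in (_ < X)%N](bigD1 i) //= [X in (_ < _ + X)%N](bigD1 j) //=.
rewrite !permM tpermL tpermR !addnA.
rewrite [X in (_ < _ + X)%N](eq_bigr (fun x => f x * g (s x))%N) => [|x /andP [xi xj]]; last first.
  by rewrite permM tpermD // eq_sym.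
by rewrite ltn_add2r; have := f_mono ij; have := g_mono ji; nia.
Qed.

Lemma rearrangement (s : 'S_b) :
  (\sum_i f i * g (s i) <= \sum_i f i * g i ?= iff (s == 1%g))%N.
Proof.
have V1 : V 1%g = (\sum_i f i * g i)%N by apply: eq_bigr => i _; rewrite perm1.
rewrite -V1 -/(V s).
have V1max : forall t, (V t <= V 1%g)%N.
  case: (@arg_maxnP _ (1%g : 'S_b) predT V isT) => m _ mmax t.
  have [<-|/rearrangement_step [m' lt]] := eqVneq m 1%g; first exact: mmax.
  by have := mmax m' isT; rewrite /= leqNgt lt.
split=> //; apply/eqP/eqP => [e|-> //].
apply/eqP; apply: contraT => /rearrangement_step [s' lt].
by have := V1max s'; rewrite -e leqNgt lt.
Qed.

End Rearrangement.

(** * Linear independence of standard basis elements *)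

Section Bideterminants.
Variables (K : fieldType) (n : nat) (la : 'I_n -> nat).
Hypothesis K_infinite : forall s : seq K, exists x : K, x \notin s.

Let Cols : finType := tbasis (fun j : 'I_(ncols la) => lbasis n (transp j)).
Let Perms : finType := tbasis (fun j : 'I_(ncols la) => 'S_(transp j)).

(** The exponents of the monomial that the choice of [s j] in the Leibniz expansion of each column
    minor contributes to their product. *)
Definition col_exp (t : Cols) (s : Perms) (q : 'I_n * 'I_n) : nat :=
  (\sum_(j < ncols la) \sum_(i < transp j)
    ((col_row i == q.1) && (tnth (val (t j)) (s j i) == q.2)))%N.

Lemma prod_bidet (t : Cols) (X : 'M[K]_n) :
  \prod_j \det (colsub (tnth (val (t j))) (\matrix_(i < transp (a := la) j) row (col_row i) X)) =
  \sum_(s : Perms) \prod_j (-1) ^+ s j * monom (fun q => X q.1 q.2) (col_exp t s).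
Proof.
rewrite bigA_distr_tbasis; apply: eq_bigr => s _.
rewrite big_split /=; congr (_ * _).
rewrite /monom; under [RHS]eq_bigr do rewrite -prodrXr.
rewrite exchange_big; apply: eq_bigr => j _ /=.
under [RHS]eq_bigr do rewrite -prodrXr.
rewrite exchange_big; apply: eq_bigr => i _ /=.
rewrite (bigD1 (col_row i, tnth (val (t j)) (s j i))) //= !eqxx /= expr1.
rewrite big1 ?mulr1 ?mxE // => -[k l] /=; rewrite xpair_eqE eq_sym [X in _ && X]eq_sym.
by move/negPf->; rewrite expr0.
Qed.

Lemma dprime_coord (t : Cols) (X : 'M[K]_n) :
  \sum_A dprime K n la (basis_vec K A) t * mx_monom A X =
  \prod_j \det (colsub (tnth (val (t j))) (\matrix_(i < transp (a := la) j) row (col_row i) X)).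
Proof.
have := congr1 (fun x : Ltens K n (transp (a := la)) => x t) (dprime_divpow la (fun i : 'I_n => row i X)).
rewrite pure_divpow_expand linear_sum sum_ffunE ffunE => E.
transitivity (\sum_A (dprime K n la (mx_monom A X *: basis_vec K A)) t).
  by apply: eq_bigr => A _; rewrite linearZ /= free_scaleE mulrC.
by rewrite E; apply: eq_bigr => j _; rewrite ffunE.
Qed.

Lemma mx_monomE (A : Dbasis n la) (X : 'M[K]_n) :
  mx_monom A X = monom (fun q => X q.1 q.2) (fun q => dexp (A q.1) q.2).
Proof. by rewrite /mx_monom pair_bigA. Qed.

(** [dprime_coord] is a polynomial identity in the entries of X; this is its coefficient at the
    monomial of A. *)
Lemma dprime_coef (t : Cols) (A : Dbasis n la) :
  dprime K n la (basis_vec K A) t =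
  \sum_(s : Perms | [forall q, col_exp t s q == dexp (A q.1) q.2]) \prod_j (-1) ^+ s j.
Proof.
rewrite -(monom_coef_eq K_infinite
  (e := fun (A : Dbasis n la) (q : 'I_n * 'I_n) => dexp (A q.1) q.2)
  (c := fun A => dprime K n la (basis_vec K A) t)).
  rewrite (big_pred1 A) // => B; apply/forallP/eqP => [e|-> //].
  by apply: Dbasis_inj => i j; apply/eqP/(e (i, j)).
move=> x; pose X : 'M[K]_n := \matrix_(i, j) x (i, j).
have Xm e : monom (fun q => X q.1 q.2) e = monom x e.
  by apply: eq_bigr => -[i j] _; rewrite mxE.
under [RHS]eq_bigr do rewrite -Xm.
rewrite -prod_bidet -dprime_coord; apply: eq_bigr => B _.
by rewrite mx_monomE Xm.
Qed.

Definition exp_weight (e : 'I_n * 'I_n -> nat) : nat := (\sum_(q : 'I_n * 'I_n) q.1 * q.2 * e q)%N.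

Lemma weightE (A : Dbasis n la) : weight A = exp_weight (fun q => dexp (A q.1) q.2).
Proof.
rewrite /exp_weight -(pair_bigA _ (fun i j : 'I_n => i * j * dexp (A i) j)%N) /=.
by apply: eq_bigr => i _; rewrite big_distrr; apply: eq_bigr => j _ /=; rewrite mulnA.
Qed.

Lemma col_exp_weight (t : Cols) (s : Perms) :
  exp_weight (col_exp t s) =
  (\sum_(j < ncols la) \sum_(i < transp j) col_row i * tnth (val (t j)) (s j i))%N.
Proof.
rewrite /exp_weight; under eq_bigr do rewrite big_distrr /=.
rewrite exchange_big; apply: eq_bigr => j _ /=.
under eq_bigr do rewrite big_distrr /=.
rewrite exchange_big; apply: eq_bigr => i _ /=.
rewrite (bigD1 (col_row i, tnth (val (t j)) (s j i))) //= !eqxx /= muln1.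
rewrite big1 ?addn0 // => -[k l] /=; rewrite xpair_eqE eq_sym [X in _ && X]eq_sym.
by move/negPf->; rewrite muln0.
Qed.

Let id_perms : Perms := [ffun j => 1%g].

Lemma col_weight_max (t : Cols) (s : Perms) :
  (exp_weight (col_exp t s) <= exp_weight (col_exp t id_perms)
     ?= iff (s == id_perms))%N.
Proof.
rewrite !col_exp_weight.
have -> : (s == id_perms) = [forall (j | true), s j == 1%g].
  apply/eqP/forallP => [-> j|e]; first by rewrite ffunE eqxx.
  by apply/ffunP => j; rewrite ffunE; apply/eqP/e.
apply: leqif_sum => j _.
under [X in (_ <= X ?= iff _)%N]eq_bigr do rewrite ffunE perm1.
apply: (rearrangement (f := fun i => col_row i) (g := fun i => tnth (val (t j)) i)).
  exact: col_row_mono.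
by move=> i i' lt; rewrite lbasis_mono.
Qed.

(** [std_exp] compares adjacent rows only; monotonicity of [cumul] chains the comparisons, as needed
    for [col_row_mono], which does not give adjacent rows. *)
Lemma std_expP (A : Dbasis n la) (i i' c : 'I_n) : std_exp A -> (i < i')%N ->
  (cumul (dexp (A i')) c.+1 <= cumul (dexp (A i)) c)%N.
Proof.
move=> stdA; case: i' => k; elim: k => [//|k IHk] lt; rewrite ltnS leq_eqVlt => ik.
have lt' := ltnW lt.
have step : (cumul (dexp (A (Ordinal lt))) c.+1 <= cumul (dexp (A (Ordinal lt'))) c)%N.
  have /forallP /(_ (Ordinal lt')) /forallP /(_ (Ordinal lt)) := stdA.
  by rewrite eqxx => /forallP /(_ c).
case/orP: ik => [/eqP ik|ik].
  have -> // : i = Ordinal lt' by apply: val_inj.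
apply: leq_trans step (leq_trans (cumul_mono _ (leqnSn c)) (IHk lt' ik)).
Qed.

(** Sorting the rows of B gives a tableau with strictly increasing columns. These columns form [t],
    and the diagonal term of their minors is the monomial of B. *)
Lemma std_columns (B : Dbasis n la) : std_exp B ->
  exists t : Cols, forall q, col_exp t id_perms q = dexp (B q.1) q.2.
Proof.
move=> stdB.
have [T TP] := fin_all_exists (fun i => sorted_word_ex (dexp_sum (B i))).
pose F (j : 'I_(ncols la)) (i : 'I_(transp j)) : 'I_n :=
  T (col_row i) (Ordinal (col_rowP i)).
have T_lt i c l : (T i l < c)%N = (l < cumul (dexp (B i)) c)%N.
  by rewrite sorted_word_lt ?(eq_cumul (TP i).2) //; case: (TP i).
have F_mono j (i i' : 'I_(transp j)) : (i < i')%N -> (F j i < F j i')%N.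
  move=> lt; rewrite T_lt /=; apply: leq_trans (std_expP _ stdB (col_row_mono lt)).
  by have := ltnSn (F j i'); rewrite {1}/F T_lt.
have F_sorted j : sorted ltn (map val [tuple F j i | i < transp j]).
  rewrite sorted_map sorted_map.
  have : sorted ltn (map val (enum 'I_(transp j))) by rewrite val_enum_ord iota_ltn_sorted.
  by rewrite sorted_map; apply: sub_sorted => i i'; apply: F_mono.
exists ([ffun j => Sub [tuple F j i | i < transp j] (F_sorted j)] : Cols) => -[k l].
rewrite /col_exp /=.
transitivity (\sum_(i < n) \sum_(x < la i) ((i == k) && (T i x == l)))%N.
  rewrite [RHS](big_boxes _ (fun i x => nat_of_bool ((i == k) && (T i x == l)))).
  apply: eq_bigr => j _; apply: eq_bigr => i _.
  by rewrite !ffunE /= perm1 tnth_mktuple.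
rewrite (bigD1 k) //= [X in (_ + X)%N]big1 ?addn0 => [|i /negPf ne]; last first.
  by apply: big1 => x _; rewrite ne.
rewrite -(TP k).2 /content -sum1dep_card [RHS]big_mkcond.
by apply: eq_bigr => x _; rewrite eqxx /=; case: (_ == _).
Qed.

(** Triangularity: by the rearrangement inequality in each column, the diagonal term is the only one
    of greatest weight in the product of minors, and its sign is 1. *)
Lemma dprime_std_lead (B : Dbasis n la) : std_exp B ->
  exists t : Cols, dprime K n la (basis_vec K B) t = 1 /\
    forall A, A != B -> dprime K n la (basis_vec K A) t != 0 -> (weight A < weight B)%N.
Proof.
move=> /std_columns [t tB]; exists t.
have wB : weight B = exp_weight (col_exp t id_perms).
  by rewrite weightE; apply: eq_bigr => q _; rewrite tB.
have wA (A : Dbasis n la) (s : Perms) : [forall q, col_exp t s q == dexp (A q.1) q.2] ->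
    weight A = exp_weight (col_exp t s).
  by move=> /forallP e; rewrite weightE; apply: eq_bigr => q _; rewrite (eqP (e q)).
split=> [|A AB].
  rewrite dprime_coef (big_pred1 id_perms) => [|s].
    by apply: big1 => j _; rewrite ffunE odd_perm1 expr0.
  apply/idP/eqP => [e|-> ]; last by apply/forallP => q; rewrite tB.
  have [_ eqw] := col_weight_max t s.
  by apply/eqP; rewrite -eqw -(wA _ _ e) wB.
rewrite dprime_coef => nz.
have /existsP [s sA] : [exists s : Perms, [forall q, col_exp t s q == dexp (A q.1) q.2]].
  apply: contraNT nz; rewrite negb_exists => /forallP H.
  by rewrite big_pred0 // => s; apply/negbTE/H.
rewrite (wA _ _ sA) wB; have [le eqw] := col_weight_max t s.
rewrite ltn_neqAle le eqw andbT; apply: contraNN AB => /eqP es.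
apply/eqP/Dbasis_inj => i j.
by have := forallP sA (i, j); rewrite es tB => /eqP.
Qed.

(** For B of least weight in the support, the coordinate from [dprime_std_lead] sees no other term
    of the relation. *)
Lemma dprime_std_indep (c : Dbasis n la -> K) :
  \sum_(A | std_exp A) c A *: dprime K n la (basis_vec K A) = 0 ->
  forall A, std_exp A -> c A = 0.
Proof.
move=> c0 A0 stdA0; apply/eqP; apply: contraT => cA0.
have PA0 : std_exp A0 && (c A0 != 0) by rewrite stdA0.
case: (@arg_minnP _ A0 (fun A => std_exp A && (c A != 0)) (@weight n la) PA0).
move=> B /andP [stdB cB] minB.
have [t [tB tA]] := dprime_std_lead stdB.
have := congr1 (fun x : Ltens K n (transp (a := la)) => x t) c0.
rewrite sum_ffunE (bigD1 B) //= free_scaleE tB mulr1 big1 => [|A /andP [stdA AB]].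
  by rewrite addr0 ffunE => e; rewrite e eqxx in cB.
rewrite free_scaleE; have [->|cA] := eqVneq (c A) 0; first by rewrite mul0r.
apply/eqP; rewrite mulf_eq0 (negPf cA) /=; apply: contraT => /(tA _ AB).
by rewrite ltnNge minB // stdA.
Qed.

End Bideterminants.

(** * The map psi *)

Section Projection.
Variables (K : fieldType) (n k : nat) (a : 'I_k -> nat).

Lemma dWeylE x : vsval (dWeyl K n a x) = dprime K n a x.
Proof.
pose F (x : Dtens K n a) := vsproj (Weyl K n a) (dprime K n a x).
have lin : linear F by move=> c u v; rewrite /F !linearP.
pose g := GRing.isLinear.Build _ _ _ _ F lin.
pose h : {linear _ -> _} := HB.pack F g.
have -> : dWeyl K n a x = F x by exact: (lfunE h).
by apply: vsprojK; apply: memv_img; rewrite memvf.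
Qed.

End Projection.

Section Generating.
Variables (K : fieldType) (n : nat) (mu : 'I_2 -> nat) (z0 : 'I_n).
Hypothesis K_infinite : forall s : seq K, exists x : K, x \notin s.
Hypothesis z0E : z0 = 0%N :> nat.
Hypothesis mu_dec : (mu ord_max <= mu ord0)%N.

Let Lmu : vectType K := Ltens K n (transp (a := mu)).

Definition Dprod (X : 'M[K]_n) (c : 'I_n -> nat) d : Dpow K n d :=
  Dmul K n c d (pure_tensor (fun s => divpow (row s X) (c s))).

Definition split_term (X : 'M[K]_n) (C : Dbasis n mu) : Lmu :=
  dprime K n mu (pure_tensor (fun i => Dprod X (dexp (C i)) (mu i))).

Definition total (C : Dbasis n mu) (s : 'I_n) : nat := (\sum_i dexp (C i) s)%N.

Definition lower0 (C : Dbasis n mu) : bool := dexp (C ord_max) z0 == 0%N.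

(* [gen s X] is d'_mu ((s_1 v_1 + w)^(mu_1) (x) w^(mu_2)) for the rows v_i of X
   and w = sum_(i >= 2) s_i v_i: the variable s_1 is omitted in the second row. *)
Definition vars (s : 'I_n -> K) (i : 'I_2) (r : 'I_n) : K :=
  if (i == ord_max) && (r == z0) then 0 else s r.

Definition gen_rows (s : 'I_n -> K) (X : 'M[K]_n) (i : 'I_2) : 'rV[K]_n :=
  \sum_r vars s i r *: row r X.

Definition gen (s : 'I_n -> K) (X : 'M[K]_n) : Lmu :=
  pure_tensor (fun j => wedge (\matrix_(i < transp (a := mu) j) gen_rows s X (col_row i))).

Lemma I2_cases (i : 'I_2) : i = ord0 \/ i = ord_max.
Proof. by case: i => [[|[|//]] lt]; [left|right]; apply: val_inj. Qed.

Lemma big_I2 (R : Type) (idx : R) (op : Monoid.law idx) (F : 'I_2 -> R) :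
  \big[op/idx]_i F i = op (F ord0) (F ord_max).
Proof.
rewrite big_ord_recl big_ord1; congr (op _ (F _)).
exact: val_inj.
Qed.

(** A term with a letter [z0] in row two carries a positive power of the variable set to 0; this
    leaves the terms with [lower0]. *)
Lemma gen_expand s X :
  gen s X = \sum_(C | lower0 C) monom s (total C) *: split_term X C.
Proof.
rewrite /gen -dprime_divpow.
rewrite (eq_pure_tensor (fun i => divpow_sum (mu i) (vars s i) (fun r => row r X))).
rewrite pure_tensor_sum linear_sum [RHS]big_mkcond; apply: eq_bigr => C _.
rewrite linearZ /=; case: ifP => [C0|nC0]; last first.
  rewrite big_I2 /= [X in _ * X](bigD1 z0) //= /vars !eqxx /= expr0n.
  by rewrite -/(lower0 C) nC0 mul0r mulr0 scale0r.
congr (_ *: _).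
rewrite exchange_big; apply: eq_bigr => r _.
rewrite big_I2 /total big_I2 exprD; congr (_ * _).
rewrite /vars eqxx /=; case: eqP => [->|//].
by rewrite (eqP C0) !expr0.
Qed.

(** By [gen_expand], the coefficient of s^e in [gen s X]. *)
Definition psi_mx (e : 'I_n -> nat) (X : 'M[K]_n) : Lmu :=
  \sum_(C | lower0 C && [forall s, total C s == e s]) split_term X C.

Lemma gen_act (g X : 'M[K]_n) s : Ltens_act (transp (a := mu)) g (gen s X) = gen s (X *m g^T).
Proof.
rewrite Ltens_act_wedge; apply: eq_pure_tensor => j; congr wedge.
apply/row_matrixP => i; rewrite row_mul !rowK /gen_rows mulmx_suml.
by apply: eq_bigr => r _; rewrite -scalemxAl row_mul.
Qed.

Lemma psi_mx_coord e X t :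
  psi_mx e X t = \sum_(C | [forall s, total C s == e s]) (lower0 C)%:R * split_term X C t.
Proof.
rewrite sum_ffunE big_mkcondl; apply: eq_bigr => C _.
by case: lower0; rewrite ?mul1r ?mul0r.
Qed.

Lemma gen_coord s X t :
  gen s X t = \sum_C (lower0 C)%:R * split_term X C t * monom s (total C).
Proof.
rewrite gen_expand sum_ffunE [LHS]big_mkcond; apply: eq_bigr => C _.
by case: lower0; rewrite ?mul1r ?mul0r // free_scaleE mulrC.
Qed.

(** Equivariance is immediate for [gen s X], a tensor product of wedges, and passes to [psi_mx] by
    comparing coefficients of s. *)
Lemma psi_mx_act e (g X : 'M[K]_n) :
  Ltens_act (transp (a := mu)) g (psi_mx e X) = psi_mx e (X *m g^T).
Proof.
apply/ffunP => t; rewrite linear_sum psi_mx_coord sum_ffunE.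
rewrite big_mkcondl /=.
rewrite (eq_bigr (fun C => (lower0 C)%:R * (Ltens_act (transp (a := mu)) g (split_term X C)) t)); last first.
  by move=> C _; case: lower0; rewrite ?mul1r ?mul0r.
apply: (monom_coef_eq K_infinite) => s.
rewrite -gen_coord -gen_act gen_expand linear_sum sum_ffunE [RHS]big_mkcond.
apply: eq_bigr => C _; rewrite linearZ /=.
by case: lower0; rewrite ?mul1r ?mul0r // free_scaleE mulrC.
Qed.

Section Evaluation.
Variable la : 'I_n -> nat.
Hypothesis mu_la : (mu ord_max <= la z0)%N.

Definition contents (T : filling n mu) : Dbasis n mu :=
  [ffun i => mk_dbasis (content_sum (T i))].

Lemma phi_divpow (T : filling n mu) (X : 'M[K]_n) : T \in ST mu la ->
  vsval (phi K la T (pure_tensor (fun s => divpow (row s X) (la s)))) =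
  split_term X (contents T).
Proof.
rewrite inE => /andP [_ /forallP wT].
rewrite /phi !comp_lfunE dWeylE; congr (dprime _ _ _ _).
rewrite tensor_map_pure.
have -> : pure_tensor (fun s => Dcomul K n (fun i => content (T i) s) (la s) (divpow (row s X) (la s))) =
  pure_tensor (fun s => pure_tensor (fun i => divpow (row s X) (content (T i) s))).
  by apply: eq_pure_tensor => s; apply: Dcomul_divpow; apply/eqP.
pose swap := fun P : tbasis (fun s => Dbasis n (fun i : 'I_2 => content (T i) s)) =>
  [ffun i => [ffun s => P s i]] : tbasis (fun i => Dbasis n (content (T i))).
pose swap' := fun P : tbasis (fun i => Dbasis n (content (T i))) =>
  [ffun s => [ffun i => P i s]] : tbasis (fun s => Dbasis n (fun i : 'I_2 => content (T i) s)).
have K1 : cancel swap swap' by move=> P; apply/ffunP => s; apply/ffunP => i; rewrite !ffunE.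
have K2 : cancel swap' swap by move=> P; apply/ffunP => s; apply/ffunP => i; rewrite !ffunE.
have -> : relabel K swap (pure_tensor (fun s => pure_tensor (fun i => divpow (row s X) (content (T i) s)))) =
  pure_tensor (fun i => pure_tensor (fun s => divpow (row s X) (content (T i) s))).
  apply/ffunP => P; rewrite (relabelE _ _ K1 K2) !ffunE.
  under eq_bigr do rewrite ffunE. under [RHS]eq_bigr do rewrite ffunE.
  rewrite exchange_big; apply: eq_bigr => i _; apply: eq_bigr => s _.
  by rewrite !ffunE.
rewrite tensor_map_pure; apply: eq_pure_tensor => i.
have -> // : dexp (contents T i) = content (T i).
by apply: functional_extensionality => s; rewrite ffunE dexp_mk.
Qed.

Lemma total_contents (T : filling n mu) s : total (contents T) s = (\sum_i content (T i) s)%N.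
Proof. by apply: eq_bigr => i _; rewrite ffunE dexp_mk. Qed.

Lemma cumul1 e : cumul e 1 = e z0.
Proof.
rewrite /cumul (big_pred1 z0) // => l; rewrite ltnS leqn0.
by rewrite -z0E; apply: val_eqE.
Qed.

Lemma standardP (T : filling n mu) : standard T <->
  (forall i, sorted_word (T i)) /\
  (forall (j : 'I_(mu ord0)) (j' : 'I_(mu ord_max)), j = j' :> nat -> (T ord0 j < T ord_max j')%N).
Proof.
split=> [/andP [/forallP rowT /forallP colT]|[rowT colT]].
  split=> [i j j' le|j j' e].
    by have /forallP /(_ j) /forallP /(_ j') /implyP := rowT i; apply.
  have /forallP /(_ ord_max) /forallP /(_ j) /forallP /(_ j') /implyP := colT ord0.
  by apply; rewrite e eqxx.
apply/andP; split; apply/forallP => i.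
  by apply/forallP => j; apply/forallP => j'; apply/implyP; apply: rowT.
apply/forallP => i'; apply/forallP => j; apply/forallP => j'; apply/implyP => /andP [lt /eqP e].
move: j j' lt e; case: (I2_cases i) => ->; case: (I2_cases i') => -> //= j j' _ e.
exact: colT.
Qed.

Lemma ST_lower0 (T : filling n mu) : T \in ST mu la ->
  lower0 (contents T) && [forall s, total (contents T) s == la s].
Proof.
rewrite inE => /andP [/standardP [rowT colT] /forallP wT].
apply/andP; split; last by apply/forallP => s; rewrite total_contents.
rewrite /lower0 ffunE dexp_mk /content cards_eq0; apply/eqP/setP => j.
rewrite !inE; apply/negbTE/eqP => e.
have lt : (j < mu ord0)%N by apply: leq_trans (ltn_ord j) mu_dec.
by have := colT (Ordinal lt) j erefl; rewrite e z0E.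
Qed.

(** A tableau with sorted rows is determined by its contents. Column strictness amounts to having no
    [z0] in row two: as mu_2 <= la_1, every box of row one above row two then holds [z0]. *)
Lemma psi_mx_ST X : \sum_(T in ST mu la) split_term X (contents T) = psi_mx la X.
Proof.
have ex (C : Dbasis n mu) : exists T : filling n mu,
    forall i, sorted_word (T i) /\ content (T i) =1 dexp (C i).
  have [T TP] := fin_all_exists (fun i => sorted_word_ex (dexp_sum (C i))).
  exists [ffun i => T i] => i; rewrite ffunE; exact: TP.
have [tab tabP] := fin_all_exists ex.
have tabK C : contents (tab C) = C.
  by apply: Dbasis_inj => i s; rewrite ffunE dexp_mk (tabP C i).2.
rewrite (reindex_onto tab contents) => [|T]; last first.
  rewrite inE => /andP [/standardP [rowT _] _]; apply/ffunP => i.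
  apply: sorted_word_inj => //; first by case: (tabP (contents T) i).
  by move=> s; rewrite (tabP (contents T) i).2 ffunE dexp_mk.
apply: eq_big => [C|C _]; last by rewrite tabK.
rewrite tabK eqxx andbT; apply/idP/idP => [/ST_lower0|/andP [/eqP C0 /forallP totC]].
  by rewrite tabK.
have totC' s : (\sum_i content (tab C i) s)%N == la s by rewrite -total_contents tabK.
rewrite inE; apply/andP; split; last by apply/forallP.
apply/standardP; split=> [i|j j' e]; first by case: (tabP C i).
have srt i : sorted_word (tab C i) by case: (tabP C i).
have lt0 : (tab C ord0 j < 1)%N.
  rewrite sorted_word_lt // cumul1 (tabP C ord0).2.
  have := eqP (totC z0); rewrite /total big_I2 C0 /= addn0 => ->.
  by rewrite e; apply: leq_trans mu_la.
apply: leq_trans lt0 _.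
by rewrite leqNgt sorted_word_lt // cumul1 (tabP C ord_max).2 C0.
Qed.

Lemma psi_divpow X :
  vsval ((\sum_(T in ST mu la) phi K la T) (pure_tensor (fun s => divpow (row s X) (la s)))) =
  psi_mx la X.
Proof.
rewrite sum_lfunE linear_sum -psi_mx_ST; apply: eq_bigr => T; exact: phi_divpow.
Qed.

End Evaluation.
End Generating.

(** * Invariance of psi under row operations *)

Section RowOperation.
Variables (K : fieldType) (n : nat) (mu : 'I_2 -> nat) (z0 : 'I_n).
Hypothesis K_infinite : forall s : seq K, exists x : K, x \notin s.
Hypothesis z0E : z0 = 0%N :> nat.
Hypothesis mu_dec : (mu ord_max <= mu ord0)%N.

Let Cols : finType := tbasis (fun j : 'I_(ncols mu) => lbasis n (transp j)).

Section Columns.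
Variables (t : Cols) (j : 'I_(ncols mu)).

Definition sub_rows (R : 'I_2 -> 'rV[K]_n) : 'M[K]_(transp j) :=
  colsub (tnth (val (t j))) (\matrix_(i < transp j) R (col_row i)).

Lemma det_col_linear (k : 'I_2) (R R1 R2 : 'I_2 -> 'rV[K]_n) (b c : K) :
  (j < mu k)%N -> R k = b *: R1 k + c *: R2 k ->
  (forall k', k' != k -> R1 k' = R k') -> (forall k', k' != k -> R2 k' = R k') ->
  \det (sub_rows R) = b * \det (sub_rows R1) + c * \det (sub_rows R2).
Proof.
move=> jk Rk R1k R2k; have [i0 i0E] := col_row_surj jk.
apply: (determinant_multilinear (i0 := i0)).
- by apply/rowP => l; rewrite !mxE i0E Rk !mxE.
- apply/matrixP => x l; rewrite !mxE R1k // -i0E (inj_eq (@col_row_inj _ _ _)).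
  by rewrite eq_sym neq_lift.
- apply/matrixP => x l; rewrite !mxE R2k // -i0E (inj_eq (@col_row_inj _ _ _)).
  by rewrite eq_sym neq_lift.
Qed.

Lemma det_col_alternate (R : 'I_2 -> 'rV[K]_n) :
  (j < mu ord_max)%N -> R ord0 = R ord_max -> \det (sub_rows R) = 0.
Proof.
move=> j1 e; have [i1 i1E] := col_row_surj j1.
have [i0 i0E] := col_row_surj (leq_trans j1 mu_dec).
apply: (determinant_alternate (i1 := i0) (i2 := i1)) => [|l].
  by apply/eqP => e01; have := congr1 val i0E; rewrite e01 i1E.
by rewrite !mxE i0E i1E e.
Qed.

Definition pair_rows (u v : 'rV[K]_n) (k : 'I_2) : 'rV[K]_n := if k == ord0 then u else v.

Lemma I2_neq_max (k : 'I_2) : k != ord_max -> k = ord0.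
Proof. by case: (I2_cases k) => ->. Qed.
Lemma I2_neq0 (k : 'I_2) : k != ord0 -> k = ord_max.
Proof. by case: (I2_cases k) => ->. Qed.

(* The second row of a column of length two turns the first row
   [(x + z) v0 + w] into [x v0]; this is where the factor [x] comes from. *)
Lemma det_col_shift (v0 w : 'rV[K]_n) : exists q : {poly K}, forall x z : K,
  \det (sub_rows (pair_rows (x *: v0 + (w + z *: v0)) (w + z *: v0))) =
  x ^+ (j < mu ord_max)%N * q.[x + z].
Proof.
have j0 : (j < mu ord0)%N.
  by have := ltn_ord j; rewrite {2}/ncols big_I2 /= (maxn_idPl mu_dec).
case: (ltnP j (mu ord_max)) => j1.
  exists (\det (sub_rows (pair_rows v0 w)))%:P => x z; rewrite hornerC expr1.
  rewrite (@det_col_linear ord0 _ (pair_rows v0 (w + z *: v0)) (pair_rows (w + z *: v0) (w + z *: v0)) x 1) //;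
    first last.
  - by move=> k /I2_neq0 ->.
  - by move=> k /I2_neq0 ->.
  - by rewrite /pair_rows /= scale1r.
  rewrite [X in _ + 1 * X]det_col_alternate // mulr0 addr0; congr (_ * _).
  rewrite (@det_col_linear ord_max _ (pair_rows v0 w) (pair_rows v0 v0) 1 z) //; first last.
  - by move=> k /I2_neq_max ->.
  - by move=> k /I2_neq_max ->.
  - by rewrite /pair_rows /= scale1r.
  by rewrite [X in _ + _ * X]det_col_alternate // mulr0 addr0 mul1r.
pose R u : 'I_2 -> 'rV[K]_n := fun _ => u.
have eR u v : \det (sub_rows (pair_rows u v)) = \det (sub_rows (R u)).
  congr (\det _); apply/matrixP => i l; rewrite !mxE /pair_rows /R.
  case: (I2_cases (col_row i)) => e; first by rewrite e eqxx.
  by have := col_rowP i; rewrite e ltnNge j1.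
exists (\det (sub_rows (R v0)) *: 'X + (\det (sub_rows (R w)))%:P) => x z.
rewrite expr0 mul1r !hornerE /= mulrC.
rewrite (@det_col_linear ord0 _ (pair_rows v0 (w + z *: v0)) (pair_rows w (w + z *: v0)) (x + z) 1) //;
  first last.
- by move=> k /I2_neq0 ->.
- by move=> k /I2_neq0 ->.
- by rewrite /pair_rows /= scale1r scalerDl ?addrA addrAC.
by rewrite !eR mul1r.
Qed.

End Columns.

Lemma gen_shift_poly (t : Cols) (v0 w : 'rV[K]_n) : exists q : {poly K}, forall x z : K,
  \prod_j \det (sub_rows t j (pair_rows (x *: v0 + (w + z *: v0)) (w + z *: v0))) =
  x ^+ mu ord_max * q.[x + z].
Proof.
have [q qP] := fin_all_exists (fun j => det_col_shift t j v0 w).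
exists (\prod_j q j) => x z; under eq_bigr do rewrite qP.
rewrite big_split /= -horner_prod; congr (_ * _).
rewrite prodrXr; congr (_ ^+ _).
rewrite -[RHS](card_ltn_ord (leq_bigmax (F := mu) ord_max)) -sum1dep_card [RHS]big_mkcond /=.
by apply: eq_bigr => j _; case: ltnP.
Qed.

Variables (X : 'M[K]_n) (i i' : 'I_n).
Hypothesis ii' : i' = i.+1 :> nat.

Let X' := add_row i i' 1 X.
(** The power of s_i that the substitution leaves alone: for the first row, one factor from each of
    the mu_2 columns of length two. *)
Let o := if i == z0 then mu ord_max else 0%N.

Let i'i : (i' == i) = false. Proof. by apply/eqP => e; move: ii'; rewrite e; lia. Qed.
Let i'z : (i' == z0) = false. Proof. by apply/eqP => e; move: ii'; rewrite e z0E. Qed.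

Lemma row_add_row r : row r X' = row r X + (r == i')%:R *: row i X.
Proof.
apply/rowP => l; rewrite !mxE; case: eqP => _; first by rewrite !mul1r.
by rewrite mul0r addr0.
Qed.

Lemma gen_rows_add (s : 'I_n -> K) k :
  gen_rows z0 s X' k = gen_rows z0 s X k + s i' *: row i X.
Proof.
rewrite /gen_rows; under eq_bigr do rewrite row_add_row scalerDr.
rewrite big_split /=; congr (_ + _).
rewrite (bigD1 i') //= big1 => [|r /negPf ->]; last by rewrite scale0r scaler0.
by rewrite eqxx scale1r addr0 /vars i'z andbF.
Qed.

Lemma gen_coord_prod (s : 'I_n -> K) Y (t : Cols) :
  gen mu z0 s Y t = \prod_j \det (sub_rows t j (gen_rows z0 s Y)).
Proof. by rewrite ffunE; apply: eq_bigr => j _; rewrite ffunE. Qed.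

Lemma gen_shift (s : 'I_n -> K) (t : Cols) :
  gen mu z0 s X' t = \sum_(C : Dbasis n mu)
    (lower0 z0 C && (o <= total C i)%N)%:R * split_term X C t *
    ((\prod_(r | r != i) s r ^+ total C r) * (s i ^+ o * (s i + s i') ^+ (total C i - o))).
Proof.
have [iz|inz] := eqVneq i z0; last first.
  pose s' r := if r == i then s i + s i' else s r.
  have -> : gen mu z0 s X' = gen mu z0 s' X.
    apply: eq_pure_tensor => j; congr wedge; apply/row_matrixP => x; rewrite !rowK.
    rewrite gen_rows_add /gen_rows (bigD1 i) //= [RHS](bigD1 i) //=.
    rewrite addrAC -scalerDl; congr (_ *: _ + _).
      by rewrite /vars (negPf inz) andbF /s' eqxx.
    by apply: eq_bigr => r /negPf ri; rewrite /vars /s' ri.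
  rewrite (gen_coord z0); apply: eq_bigr => C _; rewrite /o (negPf inz) andbT; congr (_ * _).
  rewrite /monom (bigD1 i) //= subn0 expr0 mul1r mulrC; congr (_ * _).
    by apply: eq_bigr => r /negPf ri; rewrite /s' ri.
  by rewrite /s' eqxx.
pose v0 := row i X.
pose w := \sum_(r | r != i) s r *: row r X.
have [q qP] := gen_shift_poly t v0 w.
have rowsE (x z : K) (s' : 'I_n -> K) (Y : 'M[K]_n) :
    (forall k, gen_rows z0 s' Y k = pair_rows (x *: v0 + (w + z *: v0)) (w + z *: v0) k) ->
    gen mu z0 s' Y t = x ^+ mu ord_max * q.[x + z].
  move=> e; rewrite gen_coord_prod -qP; apply: eq_bigr => j _; congr (\det _).
  by apply/matrixP => a b; rewrite !mxE e.
pose sx x r := if r == i then x else s r.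
have rowsX x k : gen_rows z0 (sx x) X k = pair_rows (x *: v0 + w) w k.
  rewrite /gen_rows (bigD1 i) //= (eq_bigr (fun r => s r *: row r X)); last first.
    by move=> r /negPf ri; rewrite /vars -iz ri andbF /sx ri.
  rewrite -/w /vars -iz eqxx andbT /sx eqxx /pair_rows.
  by case: (I2_cases k) => -> //=; rewrite scale0r add0r.
pose c (C : Dbasis n mu) : K := (lower0 z0 C)%:R * split_term X C t * \prod_(r | r != i) s r ^+ total C r.
have Pq : \sum_C c C *: 'X^(total C i) = 'X^(mu ord_max) * q.
  apply: (poly_fun_ext K_infinite) => x; rewrite hornerM hornerXn horner_sum.
  have <- : gen mu z0 (sx x) X t = x ^+ mu ord_max * q.[x].
    by rewrite -[x in q.[x]]addr0; apply: rowsE => k; rewrite rowsX scale0r addr0.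
  rewrite (gen_coord z0); apply: eq_bigr => C _.
  rewrite hornerZ hornerXn /c -!mulrA; congr (_ * (_ * _)).
  rewrite /monom [RHS](bigD1 i) //= /sx eqxx mulrC; congr (_ * _).
  by apply: eq_bigr => r /negPf ->.
have qE : q = \sum_(C | (mu ord_max <= total C i)%N) c C *: 'X^(total C i - mu ord_max).
  apply/polyP => d; have := congr1 (fun p : {poly K} => p`_(mu ord_max + d)) Pq.
  rewrite coefXnM ltnNge leq_addr /= addKn => <-.
  rewrite !coef_sum [RHS]big_mkcond; apply: eq_bigr => C _.
  rewrite !coefZ !coefXn; case: leqP => le; rewrite ?coefZ ?coefXn.
    by congr (_ * _%:R); rewrite -[d == _](eqn_add2l (mu ord_max)) subnKC.
  by rewrite [_ == _]gtn_eqF ?mulr0 // (leq_trans le (leq_addr _ _)).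
rewrite (rowsE (s i) (s i') s X'); last first.
  move=> k; have := rowsX (s i) k; rewrite gen_rows_add.
  have -> : gen_rows z0 (sx (s i)) X k = gen_rows z0 s X k.
    by apply: eq_bigr => r _; rewrite /vars /sx; case: (eqVneq r i) => [->|].
  move=> ->; rewrite /pair_rows -/v0; case: eqP => _ //.
  by rewrite addrA.
rewrite qE horner_sum big_distrr /= [LHS]big_mkcond; apply: eq_bigr => C _.
rewrite /o iz eqxx; case: leqP => le; rewrite ?andbT ?andbF ?mul0r //.
rewrite hornerZ hornerXn /c -iz; ring.
Qed.

End RowOperation.

(** * Vanishing binomials and invariance of psi *)

Section Invariance.
Variables (K : fieldType) (n : nat) (mu : 'I_2 -> nat) (z0 : 'I_n) (la : 'I_n -> nat).
Hypothesis K_infinite : forall s : seq K, exists x : K, x \notin s.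
Hypothesis z0E : z0 = 0%N :> nat.
Hypothesis mu_dec : (mu ord_max <= mu ord0)%N.
Hypothesis mu_la : (mu ord_max <= la z0)%N.

(** The index h counts the factors s_i' taken from the power of s_i + s_i' in [gen_shift]. Terms
    with h = 0 give back [psi_mx]; in the coefficient of s^la the others have
    [total C i = la i + h], hence the binomial in the hypothesis. *)
Lemma psi_mx_add_row (i i' : 'I_n) (X : 'M[K]_n) : i' = i.+1 :> nat ->
  (forall h, (0 < h <= la i')%N -> (i == z0 -> la i + h <= mu ord0)%N ->
     ('C(la i - (if i == z0 then mu ord_max else 0) + h, h)%:R = 0 :> K)) ->
  psi_mx mu z0 la (add_row i i' 1 X) = psi_mx mu z0 la X.
Proof.
move=> ii' bin0K; apply/ffunP => t; rewrite !psi_mx_coord.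
set o := if i == z0 then _ else _ in bin0K.
have i'i : i' != i by apply/eqP => e; move: ii'; rewrite e; lia.
pose N := (mu ord0 + mu ord_max)%N.
pose co (b : Dbasis n mu * 'I_N.+1) : K :=
  (lower0 z0 b.1 && (o <= total b.1 i)%N)%:R * split_term X b.1 t * 'C(total b.1 i - o, b.2)%:R.
pose ex (b : Dbasis n mu * 'I_N.+1) (r : 'I_n) : nat :=
  (if r == i then o + (total b.1 i - o - b.2) else total b.1 r + (if r == i' then b.2 : nat else 0))%N.
rewrite (monom_coef_eq K_infinite (f := ex) (d := co)); last first.
  move=> s; rewrite -gen_coord (gen_shift K_infinite z0E mu_dec) //.
  rewrite -(pair_bigA _ (fun C h => co (C, h) * monom s (ex (C, h)))) /=.
  apply: eq_bigr => C _.
  have leN : (total C i - o <= N)%N.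
    rewrite (leq_trans (leq_subr _ _)) // /total big_I2 /=.
    by apply: leq_add; apply: dexp_le.
  rewrite (exprDn_widen _ _ leN) !big_distrr /=; apply: eq_bigr => h _.
  have -> : monom s (ex (C, h)) = s i ^+ o * s i ^+ (total C i - o - h) *
      (\prod_(r | r != i) s r ^+ total C r * s i' ^+ h).
    rewrite /monom (bigD1 i) //= /ex /= eqxx exprD; congr (_ * _).
    rewrite (eq_bigr (fun r => s r ^+ total C r * s r ^+ (if r == i' then h : nat else 0))); last first.
      by move=> r /negPf ->; rewrite exprD.
    rewrite big_split /=; congr (_ * _); rewrite (bigD1 i') //= eqxx big1 ?mulr1 //.
    by move=> r /andP [_ /negPf ->].
  by rewrite /co /= -/o -[_ *+ 'C(_, _)]mulr_natl; ring.
rewrite big_mkcond -(pair_bigA _ (fun C h =>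
  if [forall j, ex (C, h) j == la j] then co (C, h) else 0)) /=.
rewrite [RHS]big_mkcond; apply: eq_bigr => C _.
rewrite big_ord_recl /= [X in _ + X]big1 ?addr0 => [|h _]; last first.
  have h0 : (0 < lift ord0 h)%N by [].
  move: (lift ord0 h) h0 => h' h'0; case: forallP => // exE.
  have := eqP (exE i); rewrite /ex /= eqxx => ei.
  have := eqP (exE i'); rewrite /ex /= (negPf i'i) eqxx => ei'.
  rewrite /co /=; case C0: (lower0 z0 C); last by rewrite !mul0r.
  case: leqP => le; last by rewrite !mul0r.
  have [lt|le'] := ltnP (total C i - o) h'; first by rewrite bin_small // mulr0.
  have -> : (total C i - o = la i - o + h')%N by lia.
  rewrite bin0K ?mulr0 //; first by rewrite h'0 -ei' leq_addl.
  (* All letters [z0] of C lie in row one, which has mu_1 boxes: this bounds h by mu_1 - la_1. *)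
  move=> iz; have -> : (la i + h' = total C i)%N by lia.
  rewrite (eqP iz) /total big_I2 /= (eqP C0) addn0; exact: dexp_le.
have -> : [forall j, ex (C, ord0) j == la j] = (o <= total C i)%N && [forall s, total C s == la s]
    || ~~ (o <= total C i)%N && [forall j, ex (C, ord0) j == la j].
  case: (leqP o (total C i)) => le /=; last by [].
  rewrite orbF; apply: eq_forallb => r; rewrite /ex /=.
  by case: (eqVneq r i) => [->|_]; [rewrite subn0 subnKC | case: (r == i'); rewrite addn0].
rewrite /co /= bin0 mulr1; case: (leqP o (total C i)) => le /=.
  by rewrite orbF andbT.
(* A discarded C exists only for i = z0 and has [total C i] below mu_2 <= la_1, so it is absent from
   [psi_mx] as well. *)
rewrite andbF mul0r if_same; case: forallP => // e.
have := le; rewrite (eqP (e i)) /o; case: eqP => [->|]; last by rewrite ltn0.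
by rewrite ltnNge mu_la.
Qed.

End Invariance.

(** * A coordinate of psi equal to 1 *)

Section NonZero.
Variables (K : fieldType) (n : nat) (mu : 'I_2 -> nat) (z0 : 'I_n) (la : 'I_n -> nat).
Hypothesis K_infinite : forall s : seq K, exists x : K, x \notin s.
Hypothesis z0E : z0 = 0%N :> nat.
Hypothesis mu_la : (mu ord_max <= la z0)%N.
Hypothesis la_mu : (la z0 <= mu ord0)%N.
Hypothesis sum_la : (\sum_s la s = mu ord0 + mu ord_max)%N.

Lemma psi_mx_neq0 : psi_mx mu z0 la (1%:M : 'M[K]_n) != 0.
Proof.
have [w [w_sorted w_content]] := sorted_word_ex sum_la.
(* The sorted word of content la is written into row one and then row two. Since mu_2 <= la_1 <=
   mu_1, its columns of length two start with [z0] and have a larger letter below; they give the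
   coordinate t. *)
pose letter (k : 'I_2) (j : nat) : 'I_n := odflt z0 (omap w (insub (k * mu ord0 + j)%N)).
have letterE (k : 'I_2) (j : nat) (lt : (k * mu ord0 + j < mu ord0 + mu ord_max)%N) :
    letter k j = w (Ordinal lt) by rewrite /letter insubT.
have w0 x : (w x < 1)%N = (x < la z0)%N.
  by rewrite sorted_word_lt // (eq_cumul w_content) (cumul1 z0E).
have letter0 j : (j < mu ord_max)%N -> letter ord0 j = z0.
  move=> lt; have lt' : (@ord0 1 * mu ord0 + j < mu ord0 + mu ord_max)%N by rewrite /=; lia.
  rewrite (letterE _ _ lt'); apply: val_inj => /=; rewrite z0E; apply/eqP.
  by rewrite -leqn0 -ltnS w0 /=; lia.
have letter1 j : (j < mu ord_max)%N -> (0 < letter ord_max j)%N.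
  move=> lt; have lt' : (@ord_max 1 * mu ord0 + j < mu ord0 + mu ord_max)%N by rewrite /=; lia.
  by rewrite (letterE _ _ lt') lt0n -leqn0 -ltnS w0 /= -leqNgt; lia.
have col_letter (j : 'I_(ncols mu)) (i i' : 'I_(transp j)) : (i < i')%N ->
    [/\ col_row i = ord0, col_row i' = ord_max & (j < mu ord_max)%N].
  move=> /col_row_mono; have := col_rowP i'.
  by case: (I2_cases (col_row i)) => ->; case: (I2_cases (col_row i')) => ->.
have t_sorted (j : 'I_(ncols mu)) :
    sorted ltn (map val [tuple letter (col_row i) j | i < transp j]).
  rewrite sorted_map sorted_map.
  have : sorted ltn (map val (enum 'I_(transp j))) by rewrite val_enum_ord iota_ltn_sorted.
  rewrite sorted_map; apply: sub_sorted => i i' /col_letter [e e' lt] /=; rewrite e e'.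
  by rewrite letter0 // z0E letter1.
pose t : tbasis (fun j : 'I_(ncols mu) => lbasis n (transp j)) :=
  [ffun j => Sub [tuple letter (col_row i) j | i < transp j] (t_sorted j)].
have genE s : gen mu z0 s 1%:M t = monom s la.
  rewrite gen_coord_prod.
  have rowsE k : gen_rows z0 s 1%:M k = \row_r vars z0 s k r.
    rewrite [RHS]row_sum_delta; apply: eq_bigr => r _.
    by rewrite mxE row1.
  transitivity (\prod_(j < ncols mu) \prod_(i < transp j) s (letter (col_row i) j)).
    (* In a column of length two the first letter is [z0], where [vars] is 0 in row two, so the
       minor is triangular. *)
    apply: eq_bigr => j _; rewrite -det_tr det_trig.
      apply: eq_bigr => i _; rewrite !mxE rowsE mxE ffunE /= tnth_mktuple /vars.
      case: eqP => //= e; case: eqP => // e0.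
      have := col_rowP i; rewrite e => /letter1.
      by move: e0; rewrite e => ->; rewrite z0E.
    apply/is_trig_mxP => i i' /col_letter [e e' lt].
    rewrite !mxE rowsE mxE ffunE /= tnth_mktuple /vars e' e letter0 //.
    by rewrite !eqxx.
  rewrite -(big_boxes _ (fun (k : 'I_2) (j : 'I_(mu k)) => s (letter k j))) big_I2 /=.
  rewrite -/(monom s la).
  have -> : monom s la = \prod_x s (w x).
    by rewrite prod_content; apply: eq_bigr => l _; rewrite w_content.
  rewrite big_split_ord /=; congr (_ * _); apply: eq_bigr => j _; congr s.
    have lt : (@ord0 1 * mu ord0 + j < mu ord0 + mu ord_max)%N by rewrite /=; have := ltn_ord j; lia.
    by rewrite (letterE _ _ lt); congr (w _); apply: val_inj.
  have lt : (@ord_max 1 * mu ord0 + j < mu ord0 + mu ord_max)%N by rewrite /=; have := ltn_ord j; lia.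
  by rewrite (letterE _ _ lt); congr (w _); apply: val_inj; rewrite /= mul1n.
apply/eqP => psi0; have := congr1 (fun x : Ltens K n (transp (a := mu)) => x t) psi0.
rewrite psi_mx_coord ffunE (monom_coef_eq K_infinite (C := unit)
   (f := fun _ => la) (d := fun _ => 1)) => [|s].
  rewrite (big_pred1 tt) => [/eqP|[]]; first by rewrite oner_eq0.
  by apply/forallP => r; rewrite eqxx.
rewrite -gen_coord genE (big_pred1 tt) ?mul1r //; by case.
Qed.

End NonZero.

(** * Factorization through dprime *)

Section DividedTensors.
Variables (K : fieldType) (n : nat) (la : 'I_n -> nat).
Hypothesis K_infinite : forall s : seq K, exists x : K, x \notin s.

Definition divpows (X : 'M[K]_n) : Dtens K n la :=
  pure_tensor (fun i => divpow (row i X) (la i)).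

Lemma linear_divpows (W : vectType K) (F : 'Hom(Dtens K n la, W)) X :
  F (divpows X) = \sum_A mx_monom A X *: F (basis_vec K A).
Proof.
rewrite /divpows pure_divpow_expand linear_sum.
by apply: eq_bigr => A _; rewrite linearZ.
Qed.

(** The elements [divpows X] span over an infinite field: values on the basis are the coefficients
    of a polynomial function of X. *)
Lemma eq_on_divpows (B : finType) (F G : 'Hom(Dtens K n la, free_mod K B)) :
  (forall X, F (divpows X) = G (divpows X)) -> F = G.
Proof.
move=> e; apply/lfunP => x; rewrite (free_mod_lin F) (free_mod_lin G).
apply: eq_bigr => A _; congr (_ *: _); apply/ffunP => b.
pose ex (A : Dbasis n la) (q : 'I_n * 'I_n) := dexp (A q.1) q.2.
have pick (H : Dbasis n la -> K) : \sum_(A' | [forall q, ex A' q == ex A q]) H A' = H A.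
  rewrite (big_pred1 A) // => A'; apply/forallP/eqP => [eA|-> //].
  by apply: Dbasis_inj => i j; apply/eqP/(eA (i, j)).
rewrite -[LHS](pick (fun A => F (basis_vec K A) b)) -[RHS](pick (fun A => G (basis_vec K A) b)).
apply: (monom_coef_eq K_infinite) => s.
pose X : 'M[K]_n := \matrix_(i, j) s (i, j).
have := congr1 (fun x : free_mod K B => x b) (e X); rewrite !linear_divpows !sum_ffunE.
have mE A' : monom s (ex A') = mx_monom A' X.
  by rewrite mx_monomE; apply: eq_bigr => -[i j] _; rewrite mxE.
under eq_bigr do rewrite free_scaleE -mE mulrC.
by under [X in _ = X -> _]eq_bigr do rewrite free_scaleE -mE mulrC.
Qed.

Lemma dprime_equivariant g :
  (Ltens_act (transp (a := la)) g \o dprime K n la)%VF = (dprime K n la \o Dtens_act la g)%VF.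
Proof.
apply: eq_on_divpows => X; rewrite comp_lfunE [RHS]comp_lfunE /divpows Dtens_act_divpow.
rewrite (dprime_divpow la (fun i => row i X)) (dprime_divpow la (fun i => row i X *m g^T)).
rewrite Ltens_act_wedge; apply: eq_pure_tensor => j; congr wedge.
by apply/row_matrixP => i; rewrite row_mul !rowK.
Qed.

Lemma Dtens_act_divpows g X : Dtens_act la g (divpows X) = divpows (X *m g^T).
Proof.
by rewrite /divpows Dtens_act_divpow; apply: eq_pure_tensor => i; rewrite row_mul.
Qed.

Lemma dprime_add_row (i i' : 'I_n) X : i' != i -> (la i' <= la i)%N ->
  dprime K n la (divpows (add_row i i' 1 X)) = dprime K n la (divpows X).
Proof.
move=> ne le; rewrite /divpows !(dprime_divpow la (fun i => row i _)); apply: eq_pure_tensor => j.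
apply/ffunP => t; rewrite !ffunE.
case: (ltnP j (la i')) => ji'; last first.
  congr (\det _); apply/matrixP => a b; rewrite !mxE; case: eqP => // e.
  by have := col_rowP a; rewrite e ltnNge ji'.
have [i0 i0E] := col_row_surj ji'; have [i1 i1E] := col_row_surj (leq_trans ji' le).
(* The difference of the two minors: row i' is replaced by row i, which already occurs since column
   j is at least as long at i as at i'. *)
pose C : 'M[K]_(transp j) := colsub (tnth (val t))
  (\matrix_(a < transp j) row (if a == i0 then i else col_row a) X).
have C0 : \det C = 0.
  have ne01 : i0 != i1.
    by apply: contraNN ne => /eqP e; rewrite -i0E -i1E e.
  apply: (determinant_alternate ne01) => b; rewrite !mxE eqxx i1E.
  by rewrite eq_sym (negPf ne01).
rewrite (determinant_multilinear (i0 := i0) (b := 1) (c := 1)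
  (B := colsub (tnth (val t)) (\matrix_(a < transp j) row (col_row a) X)) (C := C)).
- by rewrite C0 mulr0 addr0 mul1r.
- by apply/rowP => b; rewrite !mxE i0E !eqxx !mul1r.
- apply/matrixP => a b; rewrite !mxE -i0E (inj_eq (@col_row_inj _ _ _)).
  by rewrite eq_sym (negPf (neq_lift _ _)).
- apply/matrixP => a b; rewrite !mxE -i0E (inj_eq (@col_row_inj _ _ _)).
  by rewrite eq_sym (negPf (neq_lift _ _)).
Qed.

(** [h] is prescribed on the independent images of the standard basis elements. The difference of
    psi and its candidate factorization is row-invariant and zero on standard elements, so
    straightening kills it coordinate by coordinate; [val_W] supplies the coordinates. *)
Lemma factor_through_dprime (W : vectType K) (B : finType)
    (val_W : 'Hom(W, free_mod K B)) (psi : 'Hom(Dtens K n la, W)) :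
  injective val_W ->
  (forall i j : 'I_n, (i <= j)%N -> (la j <= la i)%N) ->
  (forall (i i' : 'I_n) X, i' = i.+1 :> nat ->
     psi (divpows (add_row i i' 1 X)) = psi (divpows X)) ->
  exists h : 'Hom(Ltens K n (transp (a := la)), W), psi = (h \o dprime K n la)%VF.
Proof.
move=> val_inj la_dec psi_inv.
pose std := pred_of_simpl [pred A | @std_exp n la A].
pose X := [tuple dprime K n la (basis_vec K (enum_val (A := std) i)) | i < #|std|].
pose Z := [tuple psi (basis_vec K (enum_val (A := std) i)) | i < #|std|].
have [h hP] := linear_of_free X Z.
have freeX : free X.
  apply/freeP => k k0 i.
  pose c (A : Dbasis n la) : K := \sum_(i | enum_val (A := std) i == A) k i.
  have cE i' : c (enum_val i') = k i'.
    by apply: big_pred1 => i''; rewrite (inj_eq enum_val_inj).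
  rewrite -cE; apply: (dprime_std_indep K_infinite (c := c)); last exact: (enum_valP (A := std) i).
  rewrite -[RHS]k0; apply: etrans (big_enum_val (A := std) (fun A => c A *: dprime K n la (basis_vec K A))) _.
  by apply: eq_bigr => i' _; rewrite cE nth_mktuple.
have hE A : std_exp A -> h (dprime K n la (basis_vec K A)) = psi (basis_vec K A).
  move=> stdA; pose i := enum_rank_in (A := std) stdA A.
  have := congr1 (fun s => nth 0 s i) (hP freeX (etrans (size_tuple Z) (esym (size_tuple X)))).
  rewrite (nth_map 0) ?size_tuple // !nth_mktuple enum_rankK_in //.
exists (linfun h).
apply/lfunP => x; rewrite (free_mod_lin psi) free_mod_lin; apply: eq_bigr => A _.
congr (_ *: _); apply: val_inj; apply/ffunP => b.
apply/eqP; rewrite -subr_eq0; apply/eqP.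
pose f A := val_W (psi (basis_vec K A)) b - val_W ((linfun h \o dprime K n la)%VF (basis_vec K A)) b.
apply: (@straightening K n la K_infinite f) => [i i' Y ii'|{}A stdA]; last first.
  by rewrite /f comp_lfunE lfunE /= hE // subrr.
have fE Y' : \sum_A f A * mx_monom A Y' =
    val_W (psi (divpows Y')) b - val_W ((linfun h \o dprime K n la)%VF (divpows Y')) b.
  rewrite !linear_divpows !linear_sum !sum_ffunE -sumrB; apply: eq_bigr => A' _.
  by rewrite !linearZ !free_scaleE /f mulrBl ![_ * mx_monom _ _]mulrC.
rewrite !fE psi_inv // [in RHS]comp_lfunE comp_lfunE dprime_add_row //.
  by apply/eqP => e; move: ii'; rewrite e; lia.
by apply: la_dec; rewrite ii'.
Qed.

End DividedTensors.

Lemma dvdn_Rgcd p x y h : (p %| Rgcd x y)%N -> (0 < h <= y)%N -> (p %| 'C(x + h - 1, h))%N.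
Proof.
move=> dvd /andP [h0 hy]; move: dvd; rewrite /Rgcd (bigD1_seq h) ?iota_uniq //=.
  by rewrite dvdn_gcd => /andP [].
by rewrite mem_index_iota h0 ltnS.
Qed.

Lemma part_tnth n (s : n.-tuple nat) (i : 'I_n) : part s i.+1 = tnth s i.
Proof. by rewrite /part (tnth_nth 0%N). Qed.

Lemma partition_dec n (s : n.-tuple nat) (i j : 'I_n) :
  sorted geq s -> (i <= j)%N -> (tnth s j <= tnth s i)%N.
Proof.
move=> srt ij; rewrite !(tnth_nth 0%N).
have geq_trans : transitive geq by move=> x y z h1 h2; apply: leq_trans h2 h1.
have := @sorted_leq_nth _ geq geq_trans leqnn 0%N _ srt i j.
by rewrite !inE size_tuple !ltn_ord; apply.
Qed.

Theorem theorem3p1 (K : fieldType) (p n r m : nat)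
    (la : n.-tuple nat) (mu : 2.-tuple nat)
    (K_infinite : forall s : seq K, exists x : K, x \notin s)
    (K_char : p \in [pchar K])
    (r_gt0 : (0 < r)%N) (le_r_n : (r <= n)%N)
    (la_part : is_partition n r la) (mu_part : is_partition n r mu)
    (m_ge2 : (2 <= m)%N)
    (la_m : part la m != 0%N)
    (la_gt_m : forall i : nat, (m < i)%N -> part la i = 0%N)
    (le_mu2_la1 : (part mu 2 <= part la 1)%N)
    (le_la1_mu1 : (part la 1 <= part mu 1)%N)
    (dvd_first : (p %| Rgcd (part la 1 - part mu 2 + 1)
                            (minn (part la 2) (part mu 1 - part la 1)))%N)
    (dvd_next : forall i : nat, (2 <= i <= m - 1)%N ->
                  (p %| Rgcd (part la i + 1) (part la i.+1))%N) :
  let psi : 'Hom(Dtens K n (tnth la), subvs_of (Weyl K n (tnth mu))) :=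
    \sum_(T in ST (tnth mu) (tnth la)) phi K (tnth la) T in
  exists psibar : 'Hom(subvs_of (Weyl K n (tnth la)),
                       subvs_of (Weyl K n (tnth mu))),
    [/\ S_hom psibar,
        psibar != 0
      & psi = (psibar \o dWeyl K n (tnth la))%VF].
Proof.
move=> psi.
pose z0 : 'I_n := Ordinal (leq_trans r_gt0 le_r_n).
have z0E : z0 = 0%N :> nat by [].
case/and3P: la_part => _ la_sorted /eqP la_sum.
case/and3P: mu_part => _ mu_sorted /eqP mu_sum.
have mu1E : part mu 1 = tnth mu ord0 by rewrite -part_tnth.
have mu2E : part mu 2 = tnth mu ord_max by rewrite -part_tnth.
have la1E : part la 1 = tnth la z0 by rewrite -part_tnth.
rewrite mu2E la1E in le_mu2_la1.
rewrite la1E mu1E in le_la1_mu1.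
have mu_dec : (tnth mu ord_max <= tnth mu ord0)%N by apply: leq_trans le_mu2_la1 _.
have sum_la : (\sum_s tnth la s = tnth mu ord0 + tnth mu ord_max)%N.
  have sumE k (s : k.-tuple nat) : (\sum_i tnth s i)%N = sumn s by rewrite sumnE big_tuple.
  by rewrite sumE la_sum -mu_sum -sumE big_I2.
pose valW : 'Hom(subvs_of (Weyl K n (tnth mu)), Ltens K n (transp (a := tnth mu))) := linfun vsval.
have valWE u : valW u = vsval u by rewrite lfunE.
have valW_inj : injective valW by move=> u v; rewrite !valWE; apply: val_inj.
have psiE X : vsval (psi (divpows (tnth la) X)) = psi_mx (tnth mu) z0 (tnth la) X.
  by apply: psi_divpow.
have psi_inv (i i' : 'I_n) (X : 'M[K]_n) : i' = i.+1 :> nat ->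
    psi (divpows (tnth la) (add_row i i' 1 X)) = psi (divpows (tnth la) X).
  move=> ii'; apply: valW_inj; rewrite !valWE !psiE.
  apply: psi_mx_add_row => // h /andP [h0 hla] hmu.
  apply/eqP; rewrite -(dvdn_pcharf K_char).
  have [iz|inz] := eqVneq i z0.
    have la2E : part la 2 = tnth la i' by rewrite -part_tnth ii' iz.
    have := dvdn_Rgcd dvd_first (h := h).
    rewrite la2E la1E mu1E mu2E -iz h0 leq_min hla /=.
    have -> : (h <= tnth mu ord0 - tnth la i)%N by have := hmu; rewrite iz eqxx => /(_ isT); lia.
    by move=> /(_ isT); rewrite addn1 addSn subn1.
  rewrite subn0.
  have i0 : (0 < i)%N by rewrite lt0n -z0E; apply: contraNN inz => /eqP /val_inj ->.
  (* Otherwise part i + 2 of la is zero and no h is admissible. *)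
  have le_m : (i.+2 <= m)%N.
    rewrite leqNgt; apply/negP => lt; have := la_gt_m _ lt.
    by rewrite -ii' part_tnth; lia.
  have i_m : (2 <= i.+1 <= m - 1)%N by lia.
  have := dvdn_Rgcd (dvd_next _ i_m) (h := h); rewrite -ii' !part_tnth.
  rewrite ii' part_tnth h0 hla => /(_ isT); rewrite addn1 addSn subn1; apply.
have [h hP] := factor_through_dprime K_infinite (val_W := valW) valW_inj
  (fun i j => partition_dec la_sorted (i := i) (j := j)) psi_inv.
pose valL : 'Hom(subvs_of (Weyl K n (tnth la)), Ltens K n (transp (a := tnth la))) := linfun vsval.
have psi_bar : psi = ((h \o valL) \o dWeyl K n (tnth la))%VF.
  apply/lfunP => x; rewrite hP comp_lfunE [RHS]comp_lfunE [RHS]comp_lfunE.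
  by rewrite [valL _]lfunE /= dWeylE.
exists (h \o valL)%VF; split=> //; last first.
  apply/eqP => h0; have := psi_mx_neq0 K_infinite z0E le_mu2_la1 le_la1_mu1 sum_la.
  by rewrite -psiE psi_bar h0 comp_lfunE zero_lfunE linear0 eqxx.
have psi_act g : (Ltens_act (transp (a := tnth mu)) g \o (valW \o psi))%VF =
    ((valW \o psi) \o Dtens_act (tnth la) g)%VF.
  apply: (eq_on_divpows K_infinite) => X.
  rewrite comp_lfunE [RHS]comp_lfunE comp_lfunE [RHS]comp_lfunE !valWE.
  by rewrite Dtens_act_divpows !psiE psi_mx_act.
move=> g u _.
(* Every element of the Weyl module is an image under dprime, which reduces equivariance of the
   factor to that of psi and dprime. *)
have /memv_imgP [x _ ux] := subvsP u.
have vsval_inj : injective (@vsval _ _ (Weyl K n (tnth la))) by exact: val_inj.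
have -> : u = dWeyl K n (tnth la) x by apply: vsval_inj; rewrite dWeylE.
have dprime_act : Ltens_act (transp (a := tnth la)) g (dprime K n (tnth la) x) =
    dprime K n (tnth la) (Dtens_act (tnth la) g x).
  have := congr1 (fun F : 'Hom(_, _) => F x) (dprime_equivariant (tnth la) K_infinite g).
  by rewrite comp_lfunE [RHS]comp_lfunE.
have -> : vsproj (Weyl K n (tnth la))
    (Ltens_act (transp (a := tnth la)) g (vsval (dWeyl K n (tnth la) x))) =
    dWeyl K n (tnth la) (Dtens_act (tnth la) g x).
  apply: vsval_inj; rewrite !dWeylE dprime_act vsprojK //.
  by apply: memv_img; rewrite memvf.
have pb y : (h \o valL)%VF (dWeyl K n (tnth la) y) = psi y by rewrite psi_bar [RHS]comp_lfunE.
rewrite !pb -!valWE.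
have := congr1 (fun F : 'Hom(_, _) => F x) (psi_act g).
by rewrite comp_lfunE [RHS]comp_lfunE comp_lfunE [RHS]comp_lfunE => ->.
Qed.
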